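(* Let $m\ge n\ge 2$, let $A\in\mathbb{C}^{m\times m}$ be Hermitian, let $\underline{w}\in\mathbb{C}^{m}$, and let \[ K_{m,n}=\begin{bmatrix}\underline{w} & A\underline{w} & \cdots & A^{n-1}\underline{w}\end{bmatrix}\in\mathbb{C}^{m\times n} \] be the associated Krylov matrix. Let $[n]_2=1$ if $n$ is odd and $[n]_2=0$ if $n$ is even. If $n\ge 4$, then for all integers $j\ge 1$ and $k\ge 0$ with $1\le j+2k\le n$, \[ \sigma_{j+2k}(K_{m,n})\le 4\left[\exp\left(\frac{\pi^2}{2\mu\big(\tan(\pi/(4\lfloor n/2\rfloor))^2\big)}\right)\right]^{-k+[n]_2}\sigma_j(K_{m,n}), \] where $\mu$ is the Gr\''otzsch ring function. The bound remains valid (for all $n\ge 2$) if $2\mu\big(\tan(\pi/(4\lfloor n/2\rfloor))^2\big)$ is replaced by $4\log(8\lfloor n/2\rfloor/\pi)$.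
   Context: $\sigma_1(X)\ge\cdots\ge\sigma_n(X)\ge 0$ denote the singular values of an $m\times n$ matrix $X$ with $m\ge n$. The Gr\''otzsch ring function is $\mu(\lambda)=\frac{\pi}{2}\,K(\sqrt{1-\lambda^2})/K(\lambda)$ for $0<\lambda<1$, where $K(\lambda)=\int_0^1 \frac{dt}{\sqrt{(1-t^2)(1-\lambda^2t^2)}}$ is the complete elliptic integral of the first kind. Here $\tan(\cdot)^2$ means the square of the tangent. *)

(* Defs.v *)
From HB Require Import structures.
From mathcomp Require Import all_boot all_order all_algebra.
From mathcomp Require Import sesquilinear spectral complex.
From mathcomp Require Import all_classical all_reals all_analysis.
Set Implicit Arguments.
Unset Strict Implicit.
Unset Printing Implicit Defensive.
Import Order.TTheory GRing.Theory Num.Theory numFieldNormedType.Exports.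
Local Open Scope classical_set_scope.
Local Open Scope ring_scope.
Local Open Scope sesquilinear_scope.

(* Square roots of the eigenvalues of X^* X, with multiplicity, in
   nonincreasing order. [complex.Re] only changes the type: the eigenvalues of
   X^* X are real and nonnegative. *)
Definition singular_values (R : realType) (m n : nat) (X : 'M[R[i]]_(m, n)) :
    seq R :=
  sort (fun x y => y <= x)
    [seq Num.sqrt (complex.Re (spectral_diag (X^t* *m X) 0 i))
    | i <- enum 'I_n].

(* One-based: meaningful for 1 <= j <= n. *)
Definition sigma (R : realType) (m n : nat) (j : nat) (X : 'M[R[i]]_(m, n)) :
    R :=
  nth 0 (singular_values X) j.-1.

Definition krylov (R : realType) (m n : nat) (A : 'M[R[i]]_m)
    (w : 'cV[R[i]]_m) : 'M[R[i]]_(m, n) :=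
  \matrix_(i < m, j < n) (A ^+ j *m w) i 0.

(* The integrand is singular at t = 1; the improper integral of this
   nonnegative function is its Lebesgue integral, finite for 0 <= l < 1. *)
Definition ellipticK (R : realType) (l : R) : R :=
  (\int[lebesgue_measure]_(t in `]0, 1[)
    (Num.sqrt ((1 - t ^+ 2) * (1 - l ^+ 2 * t ^+ 2)))^-1)%R.

Definition grotzsch_mu (R : realType) (l : R) : R :=
  pi / 2 * (ellipticK (Num.sqrt (1 - l ^+ 2)) / ellipticK l).

(* Main.v *)
Require Import Defs.
From HB Require Import structures.
From mathcomp Require Import all_boot all_order all_algebra.
From mathcomp Require Import sesquilinear spectral complex.
From mathcomp Require Import all_classical all_reals all_analysis.
From mathcomp Require Import measurable_realfun.
From mathcomp Require Import ring lra.
From mathcomp Require Import zify.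
Import Order.TTheory GRing.Theory Num.Theory numFieldNormedType.Exports.
Local Open Scope ring_scope.
Local Open Scope sesquilinear_scope.

Set Implicit Arguments.
Unset Strict Implicit.
Unset Printing Implicit Defensive.

(** Why the bound holds.

    Read a vector [c] as the polynomial with these coefficients. The Krylov
    matrix [K] sends it to [c(A) w], so [|K c|^2] is the sum of
    [|c(l)|^2 |u_l|^2] over the real eigenvalues [l] of [A], with weights
    [u_l] that do not depend on [c] (norm2_krylov). On the other side, if [c]
    has degree less than [2p], Parseval on the [2p] roots of [z^(2p) = -1]
    computes [|c|^2] from the values of [c] there (parseval). Let
    [p] be the half of [n], and let [g], [q] be polynomials of degree [2k] with
    [|q| <= |g|] on the real line and [|g| <= eta |q|] at these roots. For every
    polynomial [f] of degree less than [2p - 2k] one gets [|K(q f)| <= |K(g f)|]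
    and [|g f| <= eta |q f|]; this holds on a space of codimension about [2k], and
    the min-max principle turns it into
    [sigma_(j+2k) <= eta sigma_j] (sigma_compare).

    The map [x = i(1-z)/(1+z)] sends the real line to the imaginary axis and the
    roots of [z^(2p) = -1] to points of [[a, 1/a]] and of its mirror image, with
    [a = tan(pi/(4p))]. If a real rational function [s = N/D], a product of
    factors [(a x - x_i)/(a x + x_i)], is at most [delta] in absolute value on
    [[a, 1/a]], then [g = 2 N D] and [q = N^2 + D^2] have the required
    properties with [eta = 2 delta], because [|s| = 1] on the imaginary axis and
    [s(-x) = 1/s(x)] (sigma_krylov).

    So everything rests on good nodes [x_i] in Zolotarev's problem on
    [[l, 1]], [l = a^2]. They are values of Jacobi's function [dn] of
    parameter [m = 1 - l^2] at equidistant arguments. The addition theorem of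
    [dn] gives
    [((dn u - dn w)/(dn u + dn w))^2 = phi(u + w) phi(u - w)] with
    [phi = (1 - dn)/(1 + dn)] (dnratio_mul), whence [s^2] is the product of
    [phi] over [2k] equidistant points of its period circle
    (zolo_ratio_sqr_circle). Two facts bound it. The product is a Riemann sum
    in the exponent, so that [log s <= k (M + o(1))] as [k] grows, [M] being the
    mean of [log phi]; and, because [s_k] is periodic in the argument of [dn],
    [s_(2k) = (s_k^2 - t^2)/(1 - t^2 s_k^2)] for some constant [t]
    (zolo_num_doubling), so that [sup s_k / 2] is at most the square root of
    [sup s_(2k) / 2]. Iterating the second fact and using the first in the limit
    gives the sharp [s_k <= 2 exp(k M)] (zolo_ratio_bound). Finally
    [M = - pi K(l)/K(sqrt(1 - l^2))] by Tonelli: the integral of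
    [log((1+D)/(1-D))/D] over the amplitude, [D = sqrt(1 - m sin^2)], is the double
    integral of [2/(1 - y^2 D^2)], and the amplitude integrates out to
    [pi/sqrt((1-y^2)(1-l^2 y^2))] (loggap_integral_ge). This is the bound with
    the Groetzsch function.

    The case [k = 1] at the complementary modulus yields
    [mu(l) <= log(4/l)] (grotzsch_mu_le), and [x <= tan x] then gives the
    second bound. *)

(** * Comparison of singular values *)

Section SingularValues.
Context {R : realType}.
Local Notation C := R[i].

(** Squared Hermitian norm, kept in the complex field so that it can be
    compared with moduli directly. *)
Definition norm2 n (v : 'cV[C]_n) : C := \sum_i `|v i 0| ^+ 2.

Lemma norm2_ge0 n (v : 'cV[C]_n) : 0 <= norm2 v.
Proof. by apply: sumr_ge0 => i _; exact: exprn_ge0. Qed.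

Lemma norm2_eq0 n (v : 'cV[C]_n) : norm2 v = 0 -> v = 0.
Proof.
move=> v0; apply/matrixP => i j; rewrite ord1 mxE; apply/eqP.
move/eqP: v0; rewrite psumr_eq0; last by move=> k _; exact: exprn_ge0.
by move=> /allP/(_ i); rewrite mem_index_enum sqrf_eq0 normr_eq0 => /(_ isT).
Qed.

Lemma norm2E n (v : 'cV[C]_n) : norm2 v = (v^t* *m v) 0 0.
Proof.
by rewrite mxE; apply: eq_bigr => i _; rewrite !mxE normCK mulrC.
Qed.

Lemma norm2_unitary n (U : 'M[C]_n) (v : 'cV[C]_n) :
  U \is unitarymx -> norm2 (U *m v) = norm2 v.
Proof.
move=> /unitarymxP/mulmx1C UU; rewrite !norm2E.
have -> : (U *m v)^t* *m (U *m v) = v^t* *m (U^t* *m U) *m v.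
  by rewrite trmx_mul map_mxM !mulmxA.
by rewrite UU mulmx1.
Qed.

Definition sing_val m n (X : 'M[C]_(m, n)) (i : 'I_n) : R :=
  Num.sqrt (complex.Re (spectral_diag (X^t* *m X) 0 i)).

(** Diagonalize [X^* X]: the eigenvalues are real because the matrix is
    Hermitian, and nonnegative because each is the value of [|X v|^2] at a unit
    eigenvector. Hence [sing_val] loses no information when it takes the real part. *)
Lemma norm2_sing_val m n (X : 'M[C]_(m, n)) (v : 'cV[C]_n) :
  norm2 (X *m v) =
  \sum_i (sing_val X i ^+ 2)%:C%C * `|(spectralmx (X^t* *m X) *m v) i 0| ^+ 2.
Proof.
pose H := X^t* *m X.
have Hh : H \is hermsymmx.
  apply/is_hermitianmxP; rewrite expr0 scale1r /H trmx_mul map_mxM.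
  by rewrite trmxCK.
have HU := spectral_unitarymx H.
have Hs : H = (spectralmx H)^t* *m diag_mx (spectral_diag H) *m spectralmx H.
  rewrite -invmx_unitary//.
  exact/orthomx_spectralP/hermitian_normalmx.
have E (u : 'cV[C]_n) : norm2 (X *m u) =
    \sum_i spectral_diag H 0 i * `|(spectralmx H *m u) i 0| ^+ 2.
  have -> : norm2 (X *m u) = (u^t* *m H *m u) 0 0.
    by rewrite norm2E /H trmx_mul map_mxM !mulmxA.
  rewrite [X in u^t* *m X]Hs; set U := spectralmx H; set D := spectral_diag H.
  have -> : u^t* *m (U^t* *m diag_mx D *m U) *m u =
            (U *m u)^t* *m (diag_mx D *m (U *m u)).
    by rewrite trmx_mul map_mxM !mulmxA.
  rewrite mxE; apply: eq_bigr => i _.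
  by rewrite mul_diag_mx !mxE normCK mulrC mulrA.
rewrite E; apply: eq_bigr => i _; congr (_ * _).
have : 0 <= spectral_diag H 0 i.
  have := norm2_ge0 (X *m ((spectralmx H)^t* *m delta_mx i 0)).
  rewrite E (bigD1 i)//= mulmxA (unitarymxP HU) mul1mx big1 => [|k ki].
    by rewrite addr0 mxE !eqxx normr1 expr1n mulr1.
  by rewrite mxE (negbTE ki) normr0 expr0n mulr0.
move=> D0; rewrite /sing_val -/H sqr_sqrtr; first by rewrite RRe_real// ger0_real.
by move: D0; rewrite lecE => /andP[].
Qed.

Lemma nth_sorted_count (s : seq R) k :
  sorted (fun x y : R => y <= x) s -> (k < size s)%N ->
  (count (fun x : R => nth 0 s k < x)%R s <= k)%N /\
  (count (fun x : R => x < nth 0 s k)%R s <= size s - k.+1)%N.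
Proof.
move=> ss ks.
have tr : transitive (fun x y : R => y <= x) by move=> a b c h1 h2; exact: le_trans h2 h1.
have mono i j : (i <= j < size s)%N -> nth 0 s j <= nth 0 s i.
  move=> /andP[ij js].
  by apply: (sorted_leq_nth tr _ _ ss) => //; rewrite inE ?(leq_ltn_trans ij).
split.
  rewrite -[X in count _ X](cat_take_drop k) count_cat.
  have -> : count (fun x : R => nth 0 s k < x)%R (drop k s) = 0%N.
    apply/eqP; rewrite -leqn0 leqNgt -has_count; apply/negP => /(has_nthP 0) [l].
    rewrite size_drop nth_drop => ilt; apply/negP; rewrite -leNgt.
    by apply: mono; rewrite leq_addr/= -ltn_subRL.
  by rewrite addn0 (leq_trans (count_size _ _))// size_take; case: ltnP.
rewrite -[X in count _ X](cat_take_drop k.+1) count_cat.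
have -> : count (fun x : R => x < nth 0 s k)%R (take k.+1 s) = 0%N.
  apply/eqP; rewrite -leqn0 leqNgt -has_count; apply/negP => /(has_nthP 0) [l].
  rewrite size_takel// => ilt; rewrite nth_take//; apply/negP; rewrite -leNgt.
  by apply: mono; rewrite -ltnS ilt.
by rewrite add0n (leq_trans (count_size _ _))// size_drop.
Qed.

(** In these counts the order of the sorted list no longer matters; they are
    all that the min-max argument needs to know about [sigma]. *)
Lemma sigma_count m n (X : 'M[C]_(m, n)) j : (1 <= j <= n)%N ->
  (#|[set i | (sigma j X < sing_val X i)%R]| <= j.-1)%N /\
  (#|[set i | (sing_val X i < sigma j X)%R]| <= n - j)%N.
Proof.
move=> /andP[j1 jn]; rewrite /sigma.
pose s := singular_values X.
have ps : perm_eq s [seq sing_val X i | i <- enum 'I_n].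
  by rewrite /s /singular_values perm_sort.
have sz : size s = n by rewrite (perm_size ps) size_map size_enum_ord.
have ss : sorted (fun x y : R => y <= x) s.
  by apply: sort_sorted => x y; exact: le_total.
have cE (p : pred R) : #|[set i | p (sing_val X i)]| = count p s.
  rewrite (permP ps) count_map cardsE cardE size_filter enumT.
  by apply: eq_count => i; rewrite !inE.
have [] := nth_sorted_count (k := j.-1) ss; first by rewrite sz prednK.
by rewrite -!cE sz prednK.
Qed.

Lemma kernel_vector p d (M : 'M[C]_(p, d)) : (p < d)%N ->
  exists2 f : 'cV[C]_d, f != 0 & M *m f = 0.
Proof.
move=> pd; have : kermx M^T != 0.
  rewrite -mxrank_eq0 mxrank_ker mxrank_tr -lt0n subn_gt0.
  exact: leq_ltn_trans (rank_leq_row _) pd.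
move=> /rowV0Pn[v /sub_kermxP vM v0]; exists v^T; first by rewrite trmx_eq0.
by apply: trmx_inj; rewrite trmx_mul trmxK trmx0.
Qed.

Lemma sing_val_ge0 m n (X : 'M[C]_(m, n)) i : 0 <= sing_val X i.
Proof. exact: sqrtr_ge0. Qed.

Lemma sigma_ge0 m n (X : 'M[C]_(m, n)) j : 0 <= sigma j X.
Proof.
rewrite /sigma; have [jn|jn] := ltnP j.-1 (size (singular_values X)); last first.
  by rewrite nth_default.
have := mem_nth 0 jn; rewrite mem_sort => /mapP[i _ ->].
exact: sing_val_ge0.
Qed.

(** A min-max argument. Some nonzero [f] has [P f] orthogonal to all right
    singular vectors above [sigma j] and [Q f] orthogonal to all those below
    [sigma i], since these are fewer than [d] linear conditions. For this [f],
    [sigma_i |Q f| <= |X Q f| <= |X P f| <= sigma_j |P f| <= sigma_j eta |Q f|]. *)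
Theorem sigma_compare m n d (X : 'M[C]_(m, n)) (P Q : 'M[C]_(n, d)) (eta : R)
    (i j : nat) :
  0 <= eta -> (1 <= j)%N -> (1 <= i <= n)%N -> (n + j <= d + i)%N -> (j <= n)%N ->
  (forall f : 'cV[C]_d, Q *m f = 0 -> f = 0) ->
  (forall f : 'cV[C]_d, norm2 (X *m (Q *m f)) <= norm2 (X *m (P *m f))) ->
  (forall f : 'cV[C]_d, norm2 (P *m f) <= (eta ^+ 2)%:C%C * norm2 (Q *m f)) ->
  sigma i X <= eta * sigma j X.
Proof.
move=> eta0 j1 /andP[i1 iN] dims jn Qinj XQP PQ.
pose U := spectralmx (X^t* *m X).
pose J := [set k | (sigma j X < sing_val X k)%R].
pose I := [set k | (sing_val X k < sigma i X)%R].
have jjn : (1 <= j <= n)%N by rewrite j1.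
have [cJ _] := sigma_count X jjn.
have iin : (1 <= i <= n)%N by rewrite i1.
have [_ cI] := sigma_count X iin.
pose M := col_mx (rowsub (enum_val : 'I_#|J| -> 'I_n) (U *m P))
                 (rowsub (enum_val : 'I_#|I| -> 'I_n) (U *m Q)).
(* [J] has at most [j - 1] elements and [I] at most [n - i], fewer than [d]
   together. *)
have [|f f0 Mf] := @kernel_vector _ _ M.
  apply: leq_ltn_trans (leq_add cJ cI) _; lia.
have fJ k : k \in J -> (U *m (P *m f)) k 0 = 0.
  move=> kJ; move/(congr1 usubmx): Mf; rewrite mul_col_mx col_mxKu.
  move/matrixP/(_ (enum_rank_in kJ k) 0); rewrite mul_rowsub_mx -mulmxA !mxE.
  by rewrite enum_rankK_in.
have fI k : k \in I -> (U *m (Q *m f)) k 0 = 0.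
  move=> kI; move/(congr1 dsubmx): Mf; rewrite mul_col_mx col_mxKd.
  move/matrixP/(_ (enum_rank_in kI k) 0); rewrite mul_rowsub_mx -mulmxA !mxE.
  by rewrite enum_rankK_in.
have UU : U \is unitarymx by exact: spectral_unitarymx.
have Qf : 0 < norm2 (Q *m f).
  rewrite lt_def norm2_ge0 andbT; apply: contra f0 => /eqP/norm2_eq0/Qinj ->.
  by [].
have low : (sigma i X ^+ 2)%:C%C * norm2 (Q *m f) <= norm2 (X *m (Q *m f)).
  rewrite [norm2 (X *m _)]norm2_sing_val -[norm2 (Q *m f)](norm2_unitary _ UU) mulr_sumr.
  apply: ler_sum => k _; have [kI|kI] := boolP (k \in I).
    by rewrite fI// normr0 expr0n/= !mulr0.
  apply: ler_wpM2r; first exact: exprn_ge0.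
  rewrite lecR ler_pXn2r ?nnegrE ?sigma_ge0 ?sing_val_ge0//.
  by move: kI; rewrite inE -leNgt.
have high : norm2 (X *m (P *m f)) <= (sigma j X ^+ 2)%:C%C * norm2 (P *m f).
  rewrite [norm2 (X *m _)]norm2_sing_val -[norm2 (P *m f)](norm2_unitary _ UU) mulr_sumr.
  apply: ler_sum => k _; have [kI|kI] := boolP (k \in J).
    by rewrite fJ// normr0 expr0n/= !mulr0.
  apply: ler_wpM2r; first exact: exprn_ge0.
  rewrite lecR ler_pXn2r ?nnegrE ?sigma_ge0 ?sing_val_ge0//.
  by move: kI; rewrite inE -leNgt.
have : (sigma i X ^+ 2)%:C%C * norm2 (Q *m f) <=
       ((eta * sigma j X) ^+ 2)%:C%C * norm2 (Q *m f).
  apply: le_trans low _; apply: le_trans (XQP f) _; apply: le_trans high _.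
  have -> : ((eta * sigma j X) ^+ 2)%:C%C * norm2 (Q *m f) =
    (sigma j X ^+ 2)%:C%C * ((eta ^+ 2)%:C%C * norm2 (Q *m f)).
    by rewrite exprMn [eta ^+ 2 * _]mulrC rmorphM mulrA.
  apply: ler_wpM2l; last exact: PQ.
  by rewrite ler0c exprn_ge0// sigma_ge0.
rewrite ler_pM2r// lecR ler_pXn2r ?nnegrE ?mulr_ge0 ?sigma_ge0//.
Qed.
End SingularValues.

(** * Vectors as polynomials *)

Section PolynomialVectors.
Context {F : fieldType}.

Definition vpoly d (f : 'cV[F]_d) : {poly F} := \sum_(c < d) f c 0 *: 'X^c.

Lemma size_vpoly d (f : 'cV[F]_d) : (size (vpoly f) <= d)%N.
Proof.
apply: (leq_trans (size_sum _ _ _)); apply/bigmax_leqP => c _.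
by apply: leq_trans (size_scale_leq _ _) _; rewrite size_polyXn.
Qed.

Lemma coef_vpoly d (f : 'cV[F]_d) (c : 'I_d) : (vpoly f)`_c = f c 0.
Proof.
rewrite /vpoly coef_sum (bigD1 c)//= coefZ coefXn eqxx mulr1.
rewrite big1 ?addr0// => k kc; rewrite coefZ coefXn.
by rewrite (inj_eq val_inj) eq_sym (negbTE kc) mulr0.
Qed.

Lemma vpoly_eq0 d (f : 'cV[F]_d) : vpoly f = 0 -> f = 0.
Proof.
by move=> f0; apply/matrixP => i j; rewrite ord1 mxE -coef_vpoly f0 coef0.
Qed.

(** Coefficients beyond degree [n - 1] are cut off; [vpoly_mulpoly_mx] has the size
    condition under which this is true multiplication by [g]. *)
Definition mulpoly_mx n d (g : {poly F}) : 'M[F]_(n, d) :=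
  \matrix_(r < n, c < d) (g * 'X^c)`_r.

Lemma mulpoly_mxE n d (g : {poly F}) (f : 'cV[F]_d) (r : 'I_n) :
  (mulpoly_mx n d g *m f) r 0 = (g * vpoly f)`_r.
Proof.
rewrite mxE /vpoly mulr_sumr coef_sum; apply: eq_bigr => c _.
by rewrite mxE -scalerAr coefZ mulrC.
Qed.

Lemma vpoly_mulpoly_mx n d (g : {poly F}) (f : 'cV[F]_d) :
  (size (g * vpoly f)%R <= n)%N -> vpoly (mulpoly_mx n d g *m f) = g * vpoly f.
Proof.
move=> gn; apply/polyP => r; have [rn|rn] := ltnP r n.
  by rewrite -[r]/(val (Ordinal rn)) coef_vpoly mulpoly_mxE.
by rewrite !nth_default ?(leq_trans _ rn)// size_vpoly.
Qed.

Lemma mulpoly_mx_inj n d (g : {poly F}) (f : 'cV[F]_d) : g != 0 ->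
  (size (g * vpoly f)%R <= n)%N -> mulpoly_mx n d g *m f = 0 -> f = 0.
Proof.
move=> g0 gn M0; apply: vpoly_eq0; apply: (mulfI g0); rewrite mulr0.
rewrite -(vpoly_mulpoly_mx gn) M0 /vpoly big1// => c _.
by rewrite mxE scale0r.
Qed.
End PolynomialVectors.

(** * Norms of Krylov combinations and of coefficient vectors *)

Section Krylov.
Context {R : realType}.
Local Notation C := R[i].

(** In an eigenbasis of [A] the combination [c(A) w] of the Krylov columns has
    the coordinates [c(l) u_l]. *)
Lemma norm2_krylov m n (A : 'M[C]_m) (w : 'cV[C]_m) (h : 'cV[C]_n) :
  A \is hermsymmx ->
  norm2 (krylov n A w *m h) =
  \sum_l (`|(vpoly h).[spectral_diag A 0 l]| *
          `|(spectralmx A *m w) l 0|) ^+ 2.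
Proof.
move=> hA; set U := spectralmx A; set D := spectral_diag A.
have UU : U \is unitarymx by exact: spectral_unitarymx.
have AE : U *m A = diag_mx D *m U.
  rewrite [X in U *m X](orthomx_spectralP (hermitian_normalmx hA)) -/U -/D !mulmxA.
  by rewrite mulmxV ?unitarymx_unit// mul1mx.
have powE k : U *m A ^+ k = diag_mx D ^+ k *m U.
  elim: k => [|k IH]; first by rewrite !expr0 mulmx1 mul1mx.
  by rewrite exprS -mulmxE mulmxA AE -mulmxA IH mulmxA mulmxE -exprS.
have diagE k (v : 'cV[C]_m) l : (diag_mx D ^+ k *m v) l 0 = D 0 l ^+ k * v l 0.
  elim: k v => [|k IH] v; first by rewrite !expr0 mul1mx mul1r.
  by rewrite exprS -mulmxE -mulmxA mul_diag_mx mxE IH exprS mulrA.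
rewrite -(norm2_unitary _ UU); apply: eq_bigr => l _; congr (_ ^+ 2).
rewrite -normrM; congr (`|_|).
have -> : krylov n A w *m h = \sum_(j < n) h j 0 *: (A ^+ j *m w).
  apply/matrixP => i k; rewrite ord1 mxE summxE; apply: eq_bigr => j _.
  by rewrite !mxE mulrC.
rewrite mulmx_sumr summxE /vpoly horner_sum mulr_suml; apply: eq_bigr => j _.
by rewrite -scalemxAr mulmxA powE -mulmxA [LHS]mxE diagE hornerZ hornerXn mulrA.
Qed.

Definition expi (t : R) : C := (cos t +i* sin t)%C.

Lemma expiD a b : expi (a + b) = expi a * expi b.
Proof. by rewrite /expi cosD sinD; apply/eqP; rewrite eq_complex/=; apply/andP; split; apply/eqP; ring. Qed.

Lemma expiMn a k : expi a ^+ k = expi (a * k%:R).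
Proof.
elim: k => [|k IH]; first by rewrite expr0 mulr0 /expi cos0 sin0.
by rewrite exprS IH -expiD -natr1 mulrDr mulr1 addrC.
Qed.

Lemma expi_norm a : `|expi a| = 1.
Proof. by rewrite normc_def /= cos2Dsin2 sqrtr1. Qed.

Lemma expi_neq1 t : 0 < t < 2 * pi -> expi t != 1.
Proof.
move=> /andP[t0 t1]; rewrite eq_complex/= negb_and; apply/orP; left.
have -> : t = (t / 2) *+ 2 by rewrite -mulr_natr divfK.
rewrite cos_mulr2n cos2sin2.
have : 0 < sin (t / 2) by apply: sin_gt0_pi; apply/andP; split; lra.
move=> s0; apply/eqP => E; have : sin (t/2) ^+ 2 = 0 by lra.
by move/eqP; rewrite sqrf_eq0 gt_eqF.
Qed.

(** The points are a common rotation of the [M]-th roots of unity, so the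
    monomials of degree less than [M] are orthogonal on them: off the diagonal the
    sum is geometric with ratio a nontrivial [M]-th root of unity. *)
Lemma parseval M (H : {poly C}) (t0 : R) : (0 < M)%N -> (size H <= M)%N ->
  \sum_(l < M) `|H.[expi (t0 + 2 * pi * l%:R / M%:R)]| ^+ 2 =
  M%:R * \sum_(r < M) `|H`_r| ^+ 2.
Proof.
move=> M0 HM; pose z l := expi (t0 + 2 * pi * l%:R / M%:R).
have M0R : (M%:R : R) != 0 by rewrite pnatr_eq0 -lt0n.
pose om := expi (2 * pi / M%:R).
have zE l : z l = expi t0 * om ^+ l.
  by rewrite /z expiD /om expiMn; congr (_ * expi _); rewrite mulrAC.
have omC : om * om^* = 1 by rewrite -normCK expi_norm expr1n.
have t0C : expi t0 * (expi t0)^* = 1 by rewrite -normCK expi_norm expr1n.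
have omM : om ^+ M = 1.
  rewrite expiMn divfK//.
  have -> : (2 * pi : R) = pi *+ 2 by rewrite mulr_natl.
  by rewrite /expi cos2pi sin2pi.
have omn1 k : (0 < k < M)%N -> om ^+ k != 1.
  move=> /andP[k0 kM]; rewrite expiMn; apply: expi_neq1.
  have p0 := @pi_gt0 R; have k0R : (0 : R) < k%:R by rewrite ltr0n.
  have M0' : (0 : R) < M%:R by rewrite ltr0n.
  rewrite -mulrA; apply/andP; split; first by rewrite !mulr_gt0 ?invr_gt0.
  by rewrite gtr_pMr ?mulr_gt0// mulrC ltr_pdivrMr// mul1r ltr_nat.
have geo u : u != 1 -> u ^+ M = 1 -> \sum_(l < M) u ^+ l = 0 :> C.
  move=> u1 uM; have := subrX1 u M; rewrite uM subrr => /esym/eqP.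
  by rewrite mulf_eq0 subr_eq0 (negbTE u1) => /eqP.
have orth (r s : 'I_M) : \sum_(l < M) (z l ^+ r * (z l)^* ^+ s) =
    if r == s then M%:R else 0.
  have E l : z l ^+ r * (z l)^* ^+ s =
      expi t0 ^+ r * (expi t0)^* ^+ s * (om ^+ r * om^* ^+ s) ^+ l.
    rewrite zE rmorphM rmorphXn !exprMn -!exprM [(l * r)%N]mulnC [(l * s)%N]mulnC.
    by rewrite /=; ring.
  under eq_bigr do rewrite E.
  rewrite -mulr_sumr; case: ifPn => [/eqP ->|rs].
    rewrite -!exprMn t0C omC !expr1n mul1r.
    under eq_bigr do rewrite expr1n.
    by rewrite sumr_const card_ord.
  rewrite geo ?mulr0//; last first.
    rewrite exprMn -!exprM ![(_ * M)%N]mulnC !exprM omM -[om^* ^+ M]rmorphXn omM.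
    by rewrite rmorph1 !expr1n mulr1.
  move: rs; rewrite -(inj_eq val_inj) neq_ltn => /orP[lt|lt].
    rewrite -(subnKC (ltnW lt)) exprD mulrA -exprMn omC expr1n mul1r.
    have := omn1 (s - r)%N; rewrite subn_gt0 lt (leq_ltn_trans (leq_subr _ _))//.
    move=> /(_ isT); apply: contra => /eqP E1; rewrite -[om]conjCK -rmorphXn E1.
    by rewrite rmorph1.
  rewrite -(subnKC (ltnW lt)) exprD mulrAC -exprMn omC expr1n mul1r.
  apply: omn1; rewrite subn_gt0 lt/=.
  exact: leq_ltn_trans (leq_subr _ _) (ltn_ord r).
have HE x : H.[x] = \sum_(r < M) H`_r * x ^+ r by exact: horner_coef_wide.
have sqE l : `|H.[z l]| ^+ 2 = \sum_(r < M) \sum_(s < M)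
    (H`_r * (H`_s)^*) * (z l ^+ r * (z l)^* ^+ s).
  rewrite normCK HE rmorph_sum mulr_suml; apply: eq_bigr => r _.
  rewrite mulr_sumr; apply: eq_bigr => s _.
  by rewrite rmorphM rmorphXn/=; ring.
under eq_bigr do rewrite -/(z _) sqE.
rewrite exchange_big mulr_sumr; apply: eq_bigr => r _.
rewrite exchange_big (bigD1 r)//= -mulr_sumr orth eqxx big1 ?addr0 => [|s sr].
  by rewrite -normCK mulrC.
by rewrite -mulr_sumr orth eq_sym (negbTE sr) mulr0.
Qed.

End Krylov.

(** * From Zolotarev nodes to singular values *)

Section KrylovBound.
Context {R : realType}.
Local Notation C := R[i].

(** The factor [a i (1 - z) - x (1 + z)], which is [1 + z] times
    [a y - x] for [y = i (1 - z)/(1 + z)]; clearing the denominator keeps the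
    point [z = -1] ordinary. *)
Definition cayley_factor (a x : R) : {poly C} :=
  (- x +i* a)%C%:P + (- x -i* a)%C *: 'X.

Lemma size_cayley_factor a x : (size (cayley_factor a x) <= 2)%N.
Proof.
rewrite (leq_trans (size_polyD _ _))// geq_max (leq_trans (size_polyC_leq1 _))//.
by rewrite (leq_trans (size_scale_leq _ _))// size_polyX.
Qed.

Definition cayley_prod (a : R) (xs : seq R) := \prod_(x <- xs) cayley_factor a x.

Lemma size_cayley_prod a xs : (size (cayley_prod a xs) <= (size xs).+1)%N.
Proof.
rewrite /cayley_prod; elim: xs => [|x xs IH]; first by rewrite big_nil size_poly1.
rewrite big_cons (leq_trans (size_polyMleq _ _))//=.
by rewrite -subn1 leq_subLR; exact: leq_add (size_cayley_factor a x) IH.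
Qed.

(** At a real point the variable [y] is purely imaginary, so [a y - x] and
    [a y + x] are reflections of each other in the imaginary axis. *)
Lemma cayley_prod_real a xs (l : R) :
  `|(cayley_prod a [seq - x | x <- xs]).[l%:C%C]| = `|(cayley_prod a xs).[l%:C%C]|.
Proof.
rewrite /cayley_prod big_map !horner_prod !normr_prod; apply: eq_bigr => x _.
rewrite /cayley_factor !hornerE !normc_def /=; congr ((Num.sqrt _)%:C)%C; ring.
Qed.

(** At [z = expi (2t)] one has [y = tan t]; half angles make both
    [1 + z] and [i (1 - z)] multiples of [expi t]. *)
Lemma cayley_prod_expi a xs (t : R) : (cayley_prod a xs).[expi (t *+ 2)] =
  (2 * expi t) ^+ size xs *
  (\prod_(x <- xs) (a * sin t - x * cos t))%:C%C.
Proof.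
rewrite /cayley_prod horner_prod; elim: xs => [|x xs IH].
  by rewrite !big_nil expr0 mulr1.
rewrite !big_cons IH /= exprS rmorphM/=.
have -> : (cayley_factor a x).[expi (t *+ 2)] =
          2 * expi t * (a * sin t - x * cos t)%:C%C; last by ring.
rewrite /cayley_factor !hornerE /expi cos_mulr2n sin_mulr2n.
have -> : (2 : C) = (2 +i* 0)%C by rewrite -[RHS]/((2 : R)%:C)%C rmorph_nat.
apply/eqP; rewrite eq_complex /=; apply/andP; split; apply/eqP.
  by have := congr1 (fun y => x * y) (cos2Dsin2 t); lra.
by have := congr1 (fun y => a * y) (cos2Dsin2 t); lra.
Qed.


Lemma cayley_prod_ratio (a delta : R) (xs : seq R) (s c : R) : 0 < c ->
  (forall t, a ^+ 2 <= t <= 1 ->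
     \prod_(x <- xs) `|t - x| <= delta * \prod_(x <- xs) (t + x)) ->
  a ^+ 2 <= a * (s / c) <= 1 ->
  `|\prod_(x <- xs) (a * s - x * c)| <=
  delta * \prod_(x <- xs) (a * s + x * c).
Proof.
move=> c0 h /h; set t := a * (s / c).
have tE : a * s = t * c by rewrite /t mulrA divfK// gt_eqF.
have -> : \prod_(x <- xs) (a * s - x * c) = c ^+ size xs * \prod_(x <- xs) (t - x).
  elim: (xs) => [|x ys IH]; first by rewrite !big_nil expr0 mulr1.
  by rewrite !big_cons IH exprS tE; ring.
have -> : \prod_(x <- xs) (a * s + x * c) = c ^+ size xs * \prod_(x <- xs) (t + x).
  elim: (xs) => [|x ys IH]; first by rewrite !big_nil expr0 mulr1.
  by rewrite !big_cons IH exprS tE; ring.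
rewrite normrM ger0_norm ?exprn_ge0 ?(ltW c0)// mulrCA normr_prod => hh.
by rewrite ler_pM2l// exprn_gt0.
Qed.

(** The angles of the roots of [z^(2p) = -1], halved, stay at distance at least
    [pi/(4p)] from [0] and [pi/2]. *)
Lemma tan_range (e t : R) : 0 < e -> e <= t <= pi / 2 - e ->
  [/\ 0 < cos t, 0 < sin t & tan e ^+ 2 <= tan e * (sin t / cos t) <= 1].
Proof.
move=> e0 /andP[et te]; have p0 := @pi_gt0 R.
have co : 0 < cos t by apply: cos_gt0_pihalf; apply/andP; split; lra.
have si : 0 < sin t by apply: sin_gt0_pi; apply/andP; split; lra.
split=> //.
have ce : 0 < cos e by apply: cos_gt0_pihalf; apply/andP; split; lra.
have se : 0 < sin e by apply: sin_gt0_pi; apply/andP; split; lra.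
have te0 : 0 < tan e by rewrite /tan divr_gt0.
have mono (u v : R) : 0 <= u -> u <= v -> v < pi / 2 -> tan u <= tan v.
  by move=> u0 uv vp; rewrite leNgt ltr_tan ?in_itv/= -?leNgt//; apply/andP; split; lra.
apply/andP; split; first by rewrite expr2 ler_pM2l// -/(tan t) mono//; lra.
have : sin t / cos t <= tan (pi / 2 - e) by rewrite -/(tan t) mono//; lra.
have -> : tan (pi / 2 - e) = (tan e)^-1.
  by rewrite /tan sinB cosB sin_pihalf cos_pihalf !mul0r !mul1r subr0 add0r invf_div.
by move=> h; rewrite -(mulfV (lt0r_neq0 te0)) ler_pM2l.
Qed.
(** With [N] and [D] the products over the nodes and over their opposites,
    compare multiplication by [g = 2 N D] and by [q = N^2 + D^2]. On the real
    line [|N| = |D|], so [|q| <= |g|]. At the roots of [z^(2p) = -1] one of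
    [|N|], [|D|] is at most [delta] times the other and, up to a common factor,
    both are real, so [|g| <= 2 delta |q|]. *)
Theorem sigma_krylov m n (A : 'M[C]_m) (w : 'cV[C]_m) (p i j : nat)
    (a delta : R) (xs : seq R) :
  A \is hermsymmx -> (0 < p)%N -> (2 * p <= n)%N ->
  a = tan (pi / (4 * p%:R)) -> 0 <= delta -> all (fun x => 0 < x) xs ->
  (forall t, a ^+ 2 <= t <= 1 ->
     \prod_(x <- xs) `|t - x| <= delta * \prod_(x <- xs) (t + x)) ->
  (1 <= j <= n)%N -> (1 <= i <= n)%N ->
  (n + j + 2 * size xs <= 2 * p + i)%N -> (2 * size xs <= 2 * p)%N ->
  sigma i (krylov n A w) <= 2 * delta * sigma j (krylov n A w).
Proof.
move=> hA p0 pn aE delta0 xs0 hxs /andP[j1 jn] iN dims dimp.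
pose N := cayley_prod a xs; pose D := cayley_prod a [seq - x | x <- xs].
pose g := (2 : C) *: (N * D); pose q := N ^+ 2 + D ^+ 2.
pose d := (2 * p - 2 * size xs)%N.
have sN : (size N <= (size xs).+1)%N by exact: size_cayley_prod.
have sD : (size D <= (size xs).+1)%N.
  by rewrite (leq_trans (size_cayley_prod _ _))// size_map.
have sprod (u v : {poly C}) : (size u <= (size xs).+1)%N ->
    (size v <= (size xs).+1)%N -> (size (u * v)%R <= (2 * size xs).+1)%N.
  move=> su sing_val'; rewrite (leq_trans (size_polyMleq _ _))// -subn1 leq_subLR.
  by rewrite (leq_trans (leq_add su sing_val'))//; lia.
have sg : (size g <= (2 * size xs).+1)%N.
  by rewrite (leq_trans (size_scale_leq _ _))// sprod.
have sq : (size q <= (2 * size xs).+1)%N.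
  by rewrite (leq_trans (size_polyD _ _))// geq_max !expr2 !sprod.
have smul (u : {poly C}) (f : 'cV[C]_d) : (size u <= (2 * size xs).+1)%N ->
    (size (u * vpoly f)%R <= 2 * p)%N.
  move=> su; rewrite (leq_trans (size_polyMleq _ _))// -subn1 leq_subLR.
  by rewrite (leq_trans (leq_add su (size_vpoly f)))// /d; lia.
have smuln (u : {poly C}) (f : 'cV[C]_d) : (size u <= (2 * size xs).+1)%N ->
    (size (u * vpoly f)%R <= n)%N.
  by move=> su; rewrite (leq_trans (smul u f su)).
have q0 : q != 0.
  have v1 ys : (cayley_prod a ys).[1] = (\prod_(x <- ys) (- (2 * x)))%:C%C.
    rewrite /cayley_prod horner_prod rmorph_prod; apply: eq_bigr => x _.
    rewrite /cayley_factor !hornerE; apply/eqP; rewrite eq_complex /=.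
    by apply/andP; split; apply/eqP; ring.
  apply/eqP => /(congr1 (horner^~ 1)); rewrite /q hornerD !horner_exp !v1 horner0.
  rewrite -!rmorphXn -rmorphD => /eqP; rewrite (fmorph_eq0 (real_complex R)).
  rewrite paddr_eq0 ?sqr_ge0// => /andP[+ _]; rewrite sqrf_eq0 => /eqP N0.
  have : \prod_(x <- xs) (- (2 * x)) != 0.
    rewrite prodf_seq_neq0; apply/allP => x /(allP xs0) x0 /=.
    by rewrite oppr_eq0 mulf_neq0// gt_eqF.
  by rewrite N0 eqxx.
apply: (@sigma_compare _ _ _ d _ (mulpoly_mx n d g) (mulpoly_mx n d q)) => //.
- by rewrite mulr_ge0.
- rewrite /d; lia.
- by move=> f; apply: mulpoly_mx_inj => //; exact: smuln.
- move=> f; rewrite !norm2_krylov// !vpoly_mulpoly_mx ?smuln//.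
  apply: ler_sum => l _; apply: lerXn2r; rewrite ?nnegrE ?mulr_ge0//.
  apply: ler_wpM2r => //; rewrite !hornerM !normrM; apply: ler_wpM2r => //.
  have /mxOverP/(_ 0 l) := hermitian_spectral_diag_real hA.
  move=> /complex_realP[y ->].
  have ND : `|D.[y%:C%C]| = `|N.[y%:C%C]| by exact: cayley_prod_real.
  rewrite /q /g !hornerE (le_trans (ler_normD _ _))// !normrX !normrM ND.
  by rewrite normr_nat -mulrA -expr2 mulrDl mul1r.
move=> f.
pose t (l : nat) : R := pi / (4 * p%:R) + pi * l%:R / (2 * p%:R).
have parsevalf (u : {poly C}) : (size u <= (2 * size xs).+1)%N ->
    (2 * p)%:R * norm2 (mulpoly_mx n d u *m f) =
    \sum_(l < 2 * p) `|u.[expi (t l *+ 2)]| ^+ 2 * `|(vpoly f).[expi (t l *+ 2)]| ^+ 2.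
  move=> su; have M0 : (0 < 2 * p)%N by lia.
  have := @parseval _ _ (u * vpoly f) (pi / (2 * p%:R)) M0 (smul u f su).
  have -> : norm2 (mulpoly_mx n d u *m f) =
      \sum_(r < 2 * p) `|(u * vpoly f)`_r| ^+ 2.
    rewrite (big_ord_widen n (fun r => `|(u * vpoly f)`_r| ^+ 2) pn) [RHS]big_mkcond.
    apply: eq_bigr => r _; rewrite mulpoly_mxE; case: ltnP => // rp.
    by rewrite nth_default ?normr0 ?expr0n//= (leq_trans (smul u f su)).
  move=> <-; apply: eq_bigr => l _; rewrite hornerM normrM exprMn /t natrM.
  have p0' : (p%:R : R) != 0 by rewrite pnatr_eq0 -lt0n.
  have -> // : pi / (2 * p%:R) + 2 * pi * l%:R / (2 * p%:R) =
     (pi / (4 * p%:R) + pi * l%:R / (2 * p%:R)) *+ 2 :> R by field.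
have p0R : (0 : C) < (2 * p)%:R by rewrite ltr0n; lia.
rewrite -(ler_pM2l p0R) [leRHS]mulrCA !parsevalf// mulr_sumr.
apply: ler_sum => l _; rewrite [leRHS]mulrA; apply: ler_wpM2r; first exact: exprn_ge0.
rewrite rmorphXn/= -exprMn; apply: lerXn2r; [by rewrite nnegrE|by rewrite nnegrE mulr_ge0// ler0c mulr_ge0|].
have HN := cayley_prod_expi a xs (t l); have HD := cayley_prod_expi a [seq - x | x <- xs] (t l).
rewrite /g /q hornerZ hornerM hornerD !horner_exp HN HD size_map big_map.
under [in \prod_(x <- xs) (_ - - _ * _)]eq_bigr do rewrite mulNr opprK.
set E := _ ^+ size xs; set nn := \prod_(x <- xs) _; set dd := \prod_(x <- xs) _.
have -> : 2 * (E * nn%:C%C * (E * dd%:C%C)) = E ^+ 2 * (2 * nn * dd)%:C%C.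
  by rewrite !rmorphM rmorph_nat/=; ring.
have -> : (E * nn%:C%C) ^+ 2 + (E * dd%:C%C) ^+ 2 = E ^+ 2 * (nn ^+ 2 + dd ^+ 2)%:C%C.
  by rewrite rmorphD !rmorphXn/=; ring.
rewrite !normrM mulrCA; apply: ler_wpM2l => //.
rewrite !normc_def/= expr0n/= !addr0 !sqrtr_sqr -rmorphM lecR.
rewrite [`|nn ^+ 2 + dd ^+ 2|]ger0_norm ?addr_ge0 ?sqr_ge0//.
rewrite !normrM normr_nat -!mulrA ler_pM2l//.
suff : `|nn| <= delta * `|dd| \/ `|dd| <= delta * `|nn|.
  have := sqr_ge0 `|nn|; have := sqr_ge0 `|dd|; rewrite -!normrX.
  rewrite -(real_normK (num_real nn)) -(real_normK (num_real dd)).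
  move: (normr_ge0 nn) (normr_ge0 dd); move: `|nn| `|dd| => u v u0 v0 _ _ [h|h].
    by have := ler_wpM2r v0 h; have := mulr_ge0 delta0 (sqr_ge0 u); lra.
  by have := ler_wpM2r u0 h; have := mulr_ge0 delta0 (sqr_ge0 v); lra.
have p0' : (0 : R) < p%:R by rewrite ltr0n.
pose e := pi / (4 * p%:R) : R.
have e0 : 0 < e by rewrite divr_gt0 ?pi_gt0 ?mulr_gt0.
have tE : t l = e * (2 * l%:R + 1).
  by rewrite /t /e; field; rewrite gt_eqF.
have pE : pi = e * (4 * p%:R) by rewrite /e divfK// mulf_neq0// gt_eqF.
(* For [l < p] the point [tan (t l)] lies in [[a, 1/a]]; for [l >= p] its
   reflection [pi - t l] does, and the two products exchange their roles. *)
have [lp|lp] := ltnP l p.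
  have /(tan_range e0)[co si r] : e <= t l <= pi / 2 - e.
    rewrite tE [in X in _ && X]pE; apply/andP; split.
      by rewrite ler_peMr// ?(ltW e0)// lerDr mulr_ge0.
    rewrite -subr_ge0 (_ : _ - _ = e * (2 * (p%:R - l%:R - 1))); last by field.
    have lpR : l%:R + 1 <= p%:R :> R by rewrite natr1 ler_nat.
    by rewrite mulr_ge0 ?(ltW e0)//; lra.
  left; have h : `|nn| <= delta * dd by rewrite /nn /dd; apply: cayley_prod_ratio => //; rewrite aE.
  by rewrite (le_trans h)// ler_wpM2l// ler_norm.
have /(tan_range e0)[co si r] : e <= pi - t l <= pi / 2 - e.
  have l2 : l%:R + 1 <= 2 * p%:R :> R by rewrite natr1 -natrM ler_nat.
  have lpR : p%:R <= l%:R :> R by rewrite ler_nat.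
  have h1 : pi - t l = e * (4 * p%:R - (2 * l%:R + 1)) by rewrite tE mulrBr -pE.
  have h2 : pi / 2 - e = e * (2 * p%:R - 1).
    by rewrite mulrBr mulr1; congr (_ - _); rewrite [in LHS]pE; field.
  rewrite h1 h2 -{1}[e]mulr1 !ler_pM2l//; apply/andP; split; lra.
have cE : cos (pi - t l) = - cos (t l) by rewrite cosB cospi sinpi; ring.
have sE : sin (pi - t l) = sin (t l) by rewrite sinB cospi sinpi; ring.
right; have h : `|dd| <= delta * nn.
  have := @cayley_prod_ratio a delta xs (sin (pi - t l)) (cos (pi - t l)) co hxs.
  rewrite aE r => /(_ isT); rewrite -aE cE sE /nn /dd.
  under eq_bigr do rewrite mulrN opprK.
  by under [in leRHS]eq_bigr do rewrite mulrN.
by rewrite (le_trans h)// ler_wpM2l// ler_norm.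
Qed.
End KrylovBound.

(** * Antiderivatives on the line *)

Section Antiderivative.
Context {R : realType}.
Local Open Scope classical_set_scope.
Implicit Types f F G : R -> R.

Lemma derive_continuous F (dF : R -> R) :
  (forall x : R, is_derive x 1 F (dF x)) -> continuous F.
Proof.
move=> dFE x; apply/differentiable_continuous/derivable1_diffP.
by case: (dFE x).
Qed.

Lemma const_of_derive0 F (a b x y : R) :
  (forall z, a < z < b -> is_derive z 1 F 0) -> a < x < b -> a < y < b -> F x = F y.
Proof.
move=> dF; wlog xy : x y / x <= y => [W hx hy|].
  by have [xy|xy] := leP x y; [exact: W|apply/esym/W => //; exact: ltW].
move=> /andP[ax xb] /andP[ay yb]; rewrite -(subKr (F y) (F x)).
have dF' z : z \in `[x, y]%R -> is_derive z 1 F 0.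
  by rewrite in_itv/= => /andP[xz zy]; apply: dF; rewrite (lt_le_trans ax)//= (le_lt_trans zy).
have H := @MVT_segment R F (fun=> 0) x y xy.
have H1 : {within `[x, y], continuous F}.
 apply: derivable_within_continuous => z /dF'; by case.
have H2 : forall z, z \in `]x, y[%R -> is_derive z 1 F 0.
  by move=> z /subset_itv_oo_cc; exact: dF'.
have [z _ E] := H H2 H1.
by rewrite E mul0r subr0. Qed.

Lemma antiderivative_right f : continuous f ->
  exists G, forall x : R, -1 < x -> is_derive x 1 G (f x).
Proof.
move=> cf; exists (fun x => (\int[lebesgue_measure]_(t in `[-1, x]) f t)%R).
move=> x x1; have xu : x < x + 1 by rewrite ltrDl.
have intf : lebesgue_measure.-integrable `[-1, x + 1] (EFin \o f).
  apply: continuous_compact_integrable; first exact: segment_compact.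
  exact: continuous_subspaceT.
have [dG GE] := continuous_FTC1_closed xu intf x1 (cf x).
by apply: DeriveDef; [exact: dG|rewrite -derive1E; exact: GE].
Qed.

(** The integral from a base point only handles the half-line to its right. The
    other half is the mirror image, and the two pieces agree on an interval
    around the origin, where they differ by a constant. *)
Lemma continuous_antiderivative f : continuous f ->
  exists F, forall x : R, is_derive x 1 F (f x).
Proof.
move=> cf; have [G dG] := antiderivative_right cf.
have [|H dH] := @antiderivative_right (fun x => f (- x)).
  by move=> x; apply: continuous_comp; [exact: opp_continuous|exact: cf].
have dHN (x : R) : x < 1 -> is_derive x 1 (fun x => - H (- x)) (f x).
  move=> x1; have := dH (- x); rewrite ltrN2 opprK => /(_ x1) dHx.
  have -> : (fun x => - H (- x)) = - (H \o -%R) by apply/funext.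
  by apply: is_derive_eq; rewrite mulrN1 opprK.
pose k := G 0 + H 0.
have GH (x : R) : -1 < x < 1 -> G x = - H (- x) + k.
  move=> x1; suff : (G x + H (- x)) = G 0 + H (- 0).
    by rewrite oppr0 -/k => <-; rewrite addrC addrK.
  apply: (@const_of_derive0 (fun x => G x + H (- x)) (-1) 1) => // [z /andP[z0 z1]|].
    have h1 := dG _ z0; have h2 := dHN _ z1.
    have -> : (fun x => G x + H (- x)) = G - (fun x => - H (- x)).
      by apply/funext => y; rewrite !fctE opprK.
    by apply: is_derive_eq; rewrite subrr.
  by rewrite ltrN10 ltr01.
exists (fun x => if 0 < x then G x else - H (- x) + k) => x.
have [x0|x0] := ltP (-1) x.
  apply: (near_eq_is_derive _ (dG _ x0)) => //.
  near=> y; case: ifPn => //; rewrite -leNgt => y0; apply: GH.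
  rewrite (le_lt_trans y0)// andbT; near: y; exact: lt_nbhsr.
have x1 : x < 1 by lra.
apply: (@near_eq_is_derive _ _ _ (fun x => - H (- x) + k)) => //.
  near=> y; case: ifPn => // y0; exfalso; move: y0; apply/negP; rewrite -leNgt.
  apply: ltW; near: y; apply: lt_nbhsl; lra.
have h := dHN _ x1.
have -> : (fun x => - H (- x) + k) = (fun x => - H (- x)) + cst k by apply/funext.
by apply: is_derive_eq; rewrite addr0.
Unshelve. all: by end_near. Qed.

End Antiderivative.

(** * Jacobi amplitude and the addition theorem *)

Section Amplitude.
Context {R : realType} (m : R).
Local Open Scope classical_set_scope.

Definition Delta (t : R) : R := Num.sqrt (1 - m * sin t ^+ 2).

(** [F] is the incomplete elliptic integral of the first kind, of parameter [m]
    (the square of the modulus), as a function of the amplitude, and [am] is its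
    inverse. *)
Definition is_amplitude (F am : R -> R) :=
  [/\ forall t : R, is_derive t 1 F (Delta t)^-1, F 0 = 0, cancel F am,
      cancel am F & forall v : R, is_derive v 1 am (Delta (am v))].

Context (m0 : 0 <= m) (m1 : m < 1).

Lemma sin2_le1 (t : R) : 0 <= sin t ^+ 2 <= 1.
Proof. by rewrite sqr_ge0/= -(cos2Dsin2 t) lerDr sqr_ge0. Qed.

Lemma Delta2_gt0 (t : R) : 0 < 1 - m * sin t ^+ 2.
Proof.
have /andP[h1 h2] := sin2_le1 t.
by rewrite subr_gt0 (le_lt_trans _ m1)// ler_piMr.
Qed.

Lemma sqr_Delta (t : R) : Delta t ^+ 2 = 1 - m * sin t ^+ 2.
Proof. by rewrite sqr_sqrtr// ltW// Delta2_gt0. Qed.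

Lemma Delta_gt0 (t : R) : 0 < Delta t.
Proof. by rewrite sqrtr_gt0 Delta2_gt0. Qed.

Lemma Delta_le1 (t : R) : Delta t <= 1.
Proof.
by rewrite -[leRHS]sqrtr1 ler_wsqrtr// lerBlDr lerDl mulr_ge0// sqr_ge0.
Qed.

Lemma continuous_Delta : continuous Delta.
Proof.
move=> t; apply: continuous_comp; last exact: sqrt_continuous.
apply: cvgB; first exact: cvg_cst.
apply: cvgM; first exact: cvg_cst.
by rewrite expr2; apply: cvgM; exact: continuous_sin.
Qed.

Lemma amplitude_exists : exists F am, is_amplitude F am.
Proof.
have cD : continuous (fun t : R => (Delta t)^-1).
  move=> t; apply: cvgV; first by rewrite gt_eqF// Delta_gt0.
  exact: continuous_Delta.
have [G dG] := continuous_antiderivative cD.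
pose F t := G t - G 0.
have dF (t : R) : is_derive t 1 F (Delta t)^-1.
  have -> : F = G - cst (G 0) by apply/funext.
  have h := dG t; by apply: is_derive_eq; rewrite subr0.
have F0 : F 0 = 0 by rewrite /F subrr.
have cF : continuous F := derive_continuous dF.
have Fge (x y : R) : x <= y -> y - x <= F y - F x.
  move=> xy; have H := @MVT_segment R F (fun t => (Delta t)^-1) x y xy.
  have H1 : {within `[x, y], continuous F} by exact: continuous_subspaceT.
  have [z _ ->] := H (fun z _ => dF z) H1.
  by rewrite ler_peMl ?subr_ge0// invf_ge1 ?Delta_gt0// Delta_le1.
have Flt (x y : R) : x < y -> F x < F y.
  by move=> xy; have := Fge _ _ (ltW xy); lra.
have Finj : injective F.
  by move=> x y E; have [/Flt|/Flt|//] := ltgtP x y; rewrite E ltxx.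
have Fsurj (v : R) : exists t, F t == v.
  have v0 := normr_ge0 v; have h1 := Fge 0 `|v| v0.
  have h2 : 0 - (- `|v|) <= F 0 - F (- `|v|) by apply: Fge; lra.
  rewrite F0 in h1 h2; have h3 := ler_norm v; have h4 := ler_norm (- v).
  rewrite normrN in h4.
  have H := @IVT R F (- `|v|) `|v| v.
  have h5 : - `|v| <= `|v| by lra.
  have H1 : {within `[- `|v|, `|v|], continuous F} by exact: continuous_subspaceT.
  have h6 : F (- `|v|) <= F (`|v|) by lra.
  have [|t _ tv] := H h5 H1; last by exists t; rewrite tv.
  by rewrite (min_l h6) (max_r h6); apply/andP; split; lra.
pose am v := xchoose (Fsurj v).
have amK : cancel am F by move=> v; exact/eqP/(xchooseP (Fsurj v)).
have FK : cancel F am by move=> t; apply: Finj; rewrite amK.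
exists F, am; split; [exact: dF|exact: F0|exact: FK|exact: amK|] => v.
rewrite -{1}(amK v) -[Delta _]invrK; apply: (@is_derive_inverse R F).
- by near=> y; exact: FK.
- by near=> y; exact: cF.
- by rewrite invr_neq0// gt_eqF// Delta_gt0.
Unshelve. all: by end_near. Qed.

Context (F am : R -> R) (Fam : is_amplitude F am).

Let dF (t : R) : is_derive t 1 F (Delta t)^-1. Proof. by case: Fam. Qed.
Let F0 : F 0 = 0. Proof. by case: Fam. Qed.
Let FK : cancel F am. Proof. by case: Fam. Qed.
Let amK : cancel am F. Proof. by case: Fam. Qed.
Let dam (v : R) : is_derive v 1 am (Delta (am v)). Proof. by case: Fam. Qed.

Let V := F (pi / 2).
Let sn v := sin (am v).
Let cn v := cos (am v).
Definition dn v := Delta (am v).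

Lemma ell_increasing (x y : R) : x < y -> F x < F y.
Proof.
move=> xy; rewrite -subr_gt0.
have H := @MVT R F (fun t => (Delta t)^-1) x y xy.
have H1 : {within `[x, y], continuous F}.
  exact/continuous_subspaceT/(derive_continuous dF).
have [z _ ->] := H (fun z _ => dF z) H1.
by rewrite mulr_gt0 ?invr_gt0 ?Delta_gt0 ?subr_gt0.
Qed.

Lemma ell_odd (t : R) : F (- t) = - F t.
Proof.
pose g t := F (- t) + F t.
suff : g t = g 0 by rewrite /g oppr0 F0 addr0 => /eqP; rewrite addr_eq0 => /eqP.
apply: is_derive_0_is_cst => x.
have -> : g = (F \o -%R) + F by apply/funext.
have h1 := dF x; have h2 := dF (- x).
by apply: is_derive_eq; rewrite /Delta sinN sqrrN mulrN1 addNr.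
Qed.

(** Both sides have the same derivative because [Delta] has period [pi]; the
    constant is found at [- pi/2], where oddness applies. *)
Lemma ell_half_period (t : R) : F (t + pi) = F t + 2 * V.
Proof.
have E (x : R) : F (x + pi) = F x + F pi.
  pose g x := F (x + pi) - F x.
  suff : g x = g 0 by rewrite /g add0r F0 subr0 => h; lra.
  apply: is_derive_0_is_cst => y.
  have -> : g = (F \o shift pi) - F by apply/funext.
  have h1 := dF y; have h2 := dF (y + pi); have h3 := is_derive_shift y 1 (pi : R).
  by apply: is_derive_eq; rewrite /Delta sinDpi sqrrN mulr1 subrr.
rewrite E; congr (_ + _); have := E (- (pi / 2)).
have -> : - (pi / 2) + pi = pi / 2 :> R by field.
by rewrite ell_odd -/V => h; lra.
Qed.

Lemma am_odd (v : R) : am (- v) = - am v.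
Proof. by rewrite -{1}(amK v) -ell_odd FK. Qed.

Lemma dn_even (v : R) : dn (- v) = dn v.
Proof. by rewrite /dn am_odd /Delta sinN sqrrN. Qed.

Lemma dn_period (v : R) : dn (v + 2 * V) = dn v.
Proof. by rewrite /dn -{1}(amK v) -ell_half_period FK /Delta sinDpi sqrrN. Qed.

Lemma dn0 : dn 0 = 1.
Proof. by rewrite /dn -F0 FK /Delta sin0 expr0n mulr0 subr0 sqrtr1. Qed.

Lemma dnV : dn V = Num.sqrt (1 - m).
Proof. by rewrite /dn FK /Delta sin_pihalf expr1n mulr1. Qed.

Lemma dn_gt0 (v : R) : 0 < dn v. Proof. exact: Delta_gt0. Qed.
Lemma dn_le1 (v : R) : dn v <= 1. Proof. exact: Delta_le1. Qed.

Let dsn (v : R) : is_derive v 1 sn (cn v * dn v).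
Proof. by have h := dam v; apply: is_derive_eq. Qed.

Let dcn (v : R) : is_derive v 1 cn (- sn v * dn v).
Proof. by have h := dam v; apply: is_derive_eq. Qed.

Let dn2 (v : R) : dn v ^+ 2 = 1 - m * sn v ^+ 2. Proof. exact: sqr_Delta. Qed.
Let cn2 (v : R) : cn v ^+ 2 = 1 - sn v ^+ 2. Proof. exact: cos2sin2. Qed.

Let ddn (v : R) : is_derive v 1 dn (- m * sn v * cn v).
Proof.
have h := dsn v; have p0 := Delta2_gt0 (am v).
have hs := is_derive1_sqrt p0.
pose q := cst 1 - m \*: (sn * sn).
have dq : is_derive v 1 q (- m * (2 * sn v * cn v * dn v)).
  apply: is_derive_eq; rewrite /GRing.scale/=; ring.
have qE : q v = 1 - m * sin (am v) ^+ 2 by rewrite /q !fctE expr2.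
have -> : dn = Num.sqrt \o q.
  by apply/funext => x; rewrite /dn /Delta /= /q !fctE expr2.
rewrite -qE in hs.
apply: is_derive_eq; rewrite qE -/(Delta (am v)) -/(dn v).
have d0 : dn v != 0 by rewrite gt_eqF// dn_gt0.
by field.
Qed.

Let B (u w : R) := 1 - m * (sn u ^+ 2 * sn w ^+ 2).
Let T (u w : R) := dn u * dn w - m * (sn u * sn w * (cn u * cn w)).

Let sn2_le1 (v : R) : 0 <= sn v ^+ 2 <= 1. Proof. exact: sin2_le1. Qed.

Let B_gt0 (u w : R) : 0 < B u w.
Proof.
have /andP[h1 h2] := sn2_le1 u; have /andP[h3 h4] := sn2_le1 w.
rewrite subr_gt0 (le_lt_trans _ m1)// ler_piMr// -[leRHS]mulr1.
exact: ler_pM.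
Qed.

(** Along [u + w] fixed the right-hand side has derivative zero, and at
    [u = 0] it is [dn w]. *)
Lemma dn_addition (u w : R) : dn (u + w) = T u w / B u w.
Proof.
pose c := u + w; pose r x := c - x.
pose g x := T x (r x) / B x (r x).
suff : g u = g 0.
  rewrite /g /r /c [u + w - u]addrAC subrr add0r subr0 => ->.
  by rewrite /T /B /sn -F0 FK sin0 F0 dn0 expr0n/= !mul0r !mulr0 !subr0 mul1r divr1.
apply: is_derive_0_is_cst => x.
have b0 : B x (r x) != 0 by rewrite gt_eqF// B_gt0.
have h1 := dsn x; have h2 := dcn x; have h3 := ddn x.
have dr : is_derive x 1 r (-1).
  have -> : r = cst c - id by apply/funext.
  by apply: is_derive_eq; rewrite sub0r.
have k1 := dsn (r x); have k2 := dcn (r x); have k3 := ddn (r x).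
pose sr := sn \o r; pose cr := cn \o r; pose dr' := dn \o r.
have j1 : is_derive x 1 sr (cn (r x) * dn (r x) * -1) by exact: is_derive1_comp.
have j2 : is_derive x 1 cr (- sn (r x) * dn (r x) * -1) by exact: is_derive1_comp.
have j3 : is_derive x 1 dr' (- m * sn (r x) * cn (r x) * -1) by exact: is_derive1_comp.
pose T1 := dn * dr' - m \*: (sn * sr * (cn * cr)).
pose B1 := cst 1 - m \*: ((sn * sn) * (sr * sr)).
have T1E : T1 x = T x (r x) by [].
have B1E : B1 x = B x (r x) by rewrite /B !expr2.
have dB : is_derive x 1 B1 (- (2 * m) * sn x * sn (r x) *
    (cn x * dn x * sn (r x) - sn x * cn (r x) * dn (r x))).
  apply: is_derive_eq; rewrite /sr !fctE /GRing.scale/=; ring.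
have dT : is_derive x 1 T1 (
    - m * sn x * cn x * dn (r x) + m * dn x * sn (r x) * cn (r x)
    - m * (cn x * dn x * sn (r x) - sn x * cn (r x) * dn (r x)) * (cn x * cn (r x))
    - m * (sn x * sn (r x)) * (- sn x * dn x * cn (r x) + cn x * sn (r x) * dn (r x))).
  apply: is_derive_eq; rewrite /sr /cr /dr' !fctE /GRing.scale/=; ring.
have -> : g = T1 * (fun y => (B1 y)^-1).
  by apply/funext => y; rewrite /g /T1 /B1 /T /B !fctE !expr2.
have b1 : B1 x != 0 by rewrite B1E.
have dBV := is_deriveV b1 dB.
apply: is_derive_eq; rewrite T1E B1E /GRing.scale/= /T /B.
move: b0; rewrite /B.
have := dn2 x; have := dn2 (r x); have := cn2 x; have := cn2 (r x).
move: (sn x) (sn (r x)) (cn x) (cn (r x)) (dn x) (dn (r x)).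
move=> s1 s2 c1 c2 d1 d2 e1 e2 e3 e4 b0; field: e1 e2 e3 e4.
by rewrite exprMn.
Qed.

Definition dnratio v := (1 - dn v) / (1 + dn v).

(** Expand [dn (u + w)] and [dn (u - w)] by the addition theorem; the
    remaining identity is algebraic modulo [cn^2 = 1 - sn^2] and
    [dn^2 = 1 - m sn^2]. *)
Lemma dnratio_mul (u w : R) : dnratio (u + w) * dnratio (u - w) =
  ((dn u - dn w) / (dn u + dn w)) ^+ 2.
Proof.
rewrite /dnratio dn_addition dn_addition /T /B.
have -> : sn (- w) = - sn w by rewrite /sn am_odd sinN.
have -> : cn (- w) = cn w by rewrite /cn am_odd cosN.
rewrite dn_even sqrrN; have b0 := B_gt0 u w; have := b0; rewrite /B.
have p1 := dn_gt0 u; have p2 := dn_gt0 w.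
have q1 := dn_gt0 (u + w); have q2 := dn_gt0 (u - w).
move: q1 q2; rewrite !dn_addition /T /B.
have -> : sn (- w) = - sn w by rewrite /sn am_odd sinN.
have -> : cn (- w) = cn w by rewrite /cn am_odd cosN.
rewrite dn_even sqrrN.
have := dn2 u; have := dn2 w; have := cn2 u; have := cn2 w.
move: p1 p2; move: (sn u) (sn w) (cn u) (cn w) (dn u) (dn w).
move=> s1 s2 c1 c2 d1 d2 d10 d20 e1 e2 e3 e4 q1 q2 bb.
have bn : 1 - m * (s1 ^+ 2 * s2 ^+ 2) != 0 by rewrite gt_eqF.
have q1' : 0 < 1 - m * (s1 ^+ 2 * s2 ^+ 2) + (d1 * d2 - m * (s1 * s2 * (c1 * c2))).
  by rewrite pmulr_lgt0 ?invr_gt0// in q1; rewrite addr_gt0.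
have q2' : 0 < 1 - m * (s1 ^+ 2 * s2 ^+ 2) + (d1 * d2 - m * (s1 * - s2 * (c1 * c2))).
  by rewrite pmulr_lgt0 ?invr_gt0// in q2; rewrite addr_gt0.
field: e1 e2 e3 e4.
by rewrite exprMn bn !gt_eqF// addr_gt0.
Qed.

Lemma am_lt (x y : R) : x < y -> am x < am y.
Proof.
move=> xy; have [//|yx|E] := ltgtP (am x) (am y).
  by have := ell_increasing yx; rewrite !amK => /(lt_trans xy); rewrite ltxx.
by move: xy; rewrite -(amK x) -(amK y) E ltxx.
Qed.

Lemma am0 : am 0 = 0. Proof. by rewrite -F0 FK. Qed.

Lemma half_period_gt0 : 0 < V.
Proof. by rewrite -F0; apply: ell_increasing; rewrite divr_gt0// pi_gt0. Qed.

Lemma dn_decreasing (x y : R) : 0 < m -> 0 <= x -> x < y -> y <= V -> dn y < dn x.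
Proof.
move=> mp x0 xy yV; rewrite /dn /Delta ltr_sqrt ?Delta2_gt0// ltrD2l ltrN2 ltr_pM2l//.
have a0 : 0 <= am x.
  by move: x0; rewrite le_eqVlt => /predU1P[<-|/am_lt]; rewrite am0// => /ltW.
have aV : am y <= pi / 2.
  move: yV; rewrite le_eqVlt => /predU1P[->|/am_lt]; first by rewrite /V FK.
  by rewrite /V FK => /ltW.
have axy := am_lt xy; have p0 := @pi_gt0 R.
rewrite ltr_pXn2r ?nnegrE ?sin_ge0_pi//; last 2 first.
- by apply/andP; split; lra.
- by apply/andP; split; lra.
by rewrite ltr_sin// in_itv/=; apply/andP; split; lra.
Qed.

Lemma dn_surjective (t : R) : Num.sqrt (1 - m) <= t <= 1 ->
  exists2 v, 0 <= v <= V & dn v = t.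
Proof.
move=> /andP[t0 t1]; have V0 := half_period_gt0.
have cdn : {within `[0, V], continuous dn}.
  exact/continuous_subspaceT/(derive_continuous ddn).
have H := @IVT R dn 0 V t (ltW V0) cdn.
rewrite dn0 dnV in H; have s1 := le_trans t0 t1.
rewrite (min_r s1) (max_l s1) t0 t1 in H; have [v] := H isT.
by rewrite in_itv/= => vV vt; exists v.
Qed.

End Amplitude.

(** * Zolotarev ratios *)

Section Zolotarev.
Context {R : realType} (dn : R -> R) (V : R).
Context (V0 : 0 < V) (dn_even : forall v, dn (- v) = dn v)
  (dn_period : forall v, dn (v + 2 * V) = dn v)
  (dn_gt0 : forall v, 0 < dn v) (dn_le1 : forall v, dn v <= 1)
  (dn_decr : forall x y, 0 <= x -> x < y -> y <= V -> dn y < dn x).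
Let ph v := (1 - dn v) / (1 + dn v).
Context (ph_mul : forall u w,
  ph (u + w) * ph (u - w) = ((dn u - dn w) / (dn u + dn w)) ^+ 2).

Let ph_even v : ph (- v) = ph v. Proof. by rewrite /ph dn_even. Qed.
Let ph_period v : ph (v + 2 * V) = ph v. Proof. by rewrite /ph dn_period. Qed.
Let ph_ge0 v : 0 <= ph v.
Proof. by rewrite divr_ge0 ?subr_ge0// addr_ge0// ltW. Qed.

Let ph_mono x y : 0 <= x -> x <= y -> y <= V -> ph x <= ph y.
Proof.
move=> x0; rewrite le_eqVlt => /predU1P[->//|xy] yV.
have h := dn_decr x0 xy yV; have h1 := dn_gt0 x; have h2 := dn_gt0 y.
rewrite /ph ler_pdivrMr ?addr_gt0// mulrAC ler_pdivlMr ?addr_gt0//.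
nra.
Qed.

(** Midpoints of a subdivision of the half period into [k] equal parts, carried to
    [[l, 1]] by [dn]. *)
Definition zolo_node k i := dn ((2 * i + 1)%:R * V / (2 * k%:R)).

Lemma zolo_node_gt0 k i : 0 < zolo_node k i. Proof. exact: dn_gt0. Qed.

Definition zolo_ratio k v := \prod_(i < k) (`|dn v - zolo_node k i| / (dn v + zolo_node k i)).

Lemma zolo_ratio_ge0 k v : 0 <= zolo_ratio k v.
Proof. by apply: prodr_ge0 => i _; rewrite divr_ge0// addr_ge0// ltW// zolo_node_gt0. Qed.

Lemma zolo_ratio_even k v : zolo_ratio k (- v) = zolo_ratio k v.
Proof. by rewrite /zolo_ratio dn_even. Qed.

Lemma zolo_ratio_sqr k v : zolo_ratio k v ^+ 2 = \prod_(i < k)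
  (ph (v + (2 * i + 1)%:R * V / (2 * k%:R)) * ph (v - (2 * i + 1)%:R * V / (2 * k%:R))).
Proof.
rewrite /zolo_ratio -prodrXl; apply: eq_bigr => i _.
by rewrite ph_mul !expr_div_n real_normK// num_real.
Qed.

(** By the product formula each node contributes [ph (v - w) ph (v + w)]; as
    [ph] has period [2V], the points [w] and [- w] together fill the odd
    multiples of [V/(2k)] on the circle. *)
Lemma zolo_ratio_sqr_circle k v : (0 < k)%N -> zolo_ratio k v ^+ 2 =
  \prod_(i < k + k) ph (v - (2 * i + 1)%:R * V / (2 * k%:R)).
Proof.
move=> k0; have k0R : k%:R != 0 :> R by rewrite pnatr_eq0 -lt0n.
rewrite zolo_ratio_sqr big_split/= big_split_ord/= mulrC; congr (_ * _).
rewrite [RHS](reindex_inj rev_ord_inj)/=; apply: eq_bigr => i _.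
rewrite -[RHS]ph_period; congr (ph _).
have -> : (2 * (k + (k - i.+1)) + 1)%:R = 4 * k%:R - 2 * i%:R - 1 :> R.
  have := ltn_ord i => ik; rewrite addnBA// natrD natrM natrB; last by lia.
  by rewrite natrD -natr1; ring.
by rewrite natrD natrM; field.
Qed.

Lemma zolo_ratio_periodic k v : (0 < k)%N -> zolo_ratio k (v + V / k%:R) = zolo_ratio k v.
Proof.
move=> k0; have k0R : k%:R != 0 :> R by rewrite pnatr_eq0 -lt0n.
apply/eqP; rewrite -(eqrXn2 (ltn0Sn 1)) ?zolo_ratio_ge0//; apply/eqP.
rewrite !zolo_ratio_sqr_circle//.
have -> : (k + k)%N = (k + k).-1.+1 by lia.
rewrite big_ord_recl/= [RHS]big_ord_recr/= mulrC; congr (_ * _).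
  apply: eq_bigr => i _; congr (ph _).
  by rewrite /bump/= add1n !natrD !natrM -natr1; field.
rewrite -[RHS]ph_period; congr (ph _).
have -> : (2 * (k + k).-1 + 1)%:R = 4 * k%:R - 1 :> R.
  have -> : (2 * (k + k).-1 + 1 = 4 * k - 1)%N by lia.
  have k4 : (1 <= 4 * k)%N by lia.
  by rewrite (natrB _ k4) natrM.
by field.
Qed.

Lemma zolo_ratio_periodicn k n v : (0 < k)%N ->
  zolo_ratio k (v + n%:R * (V / k%:R)) = zolo_ratio k v.
Proof.
move=> k0; elim: n => [|n IH]; first by rewrite mul0r addr0.
by rewrite -natr1 mulrDl mul1r addrA zolo_ratio_periodic.
Qed.

(** By periodicity and evenness [v] may be taken between [0] and half a step.
    Then the arguments in the circle product pair up, up to sign, as two in each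
    interval [[i h, (i+1) h]], where the increasing function [ph] is largest at the
    right end. *)
Lemma zolo_ratio_le k v : (0 < k)%N ->
  zolo_ratio k v <= \prod_(i < k) ph (i.+1%:R * V / k%:R).
Proof.
move=> k0; have k0R : 0 < k%:R :> R by rewrite ltr0n.
have kn0 : k%:R != 0 :> R by rewrite gt_eqF.
pose h := V / k%:R; have h0 : 0 < h by rewrite divr_gt0.
have small r : 0 <= r <= h / 2 -> zolo_ratio k r <= \prod_(i < k) ph (i.+1%:R * V / k%:R).
  move=> /andP[r0 rh]; rewrite -(ler_pXn2r (ltn0Sn 1)) ?nnegrE ?zolo_ratio_ge0 ?prodr_ge0//.
  rewrite zolo_ratio_sqr -prodrXl; apply: ler_prod => i _; rewrite mulr_ge0//= expr2.
  have E : (2 * i + 1)%:R * V / (2 * k%:R) = i%:R * h + h / 2 :> R.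
    by rewrite natrD natrM /h; field.
  have E2 : i.+1%:R * V / k%:R = i%:R * h + h by rewrite -natr1 /h; field.
  have iV : i%:R * h + h <= V.
    by rewrite -E2 -mulrA mulrCA ger_pMr// ler_pdivrMr// mul1r ler_nat.
  have ih : 0 <= i%:R * h by rewrite mulr_ge0// ltW.
  rewrite E E2; apply: ler_pM => //.
    by apply: ph_mono => //; lra.
  rewrite -ph_even; apply: ph_mono => //; lra.
wlog v0 : v / 0 <= v => [W|].
  by have [|v0] := leP 0 v; [exact: W|rewrite -zolo_ratio_even W// oppr_ge0 ltW].
pose n := Num.truncn (v / h); pose r := v - n%:R * h.
have /andP[n1 n2] : n%:R <= v / h < n.+1%:R.
  by apply: truncn_itv; rewrite divr_ge0// ltW.
rewrite ler_pdivlMr// in n1; rewrite ltr_pdivrMr// -natr1 mulrDl mul1r in n2.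
have vE : zolo_ratio k v = zolo_ratio k r.
  by rewrite -(zolo_ratio_periodicn n r k0) /r subrK.
rewrite vE; have [rh|rh] := leP r (h / 2); first by apply: small; rewrite rh /r; lra.
rewrite -zolo_ratio_even -(zolo_ratio_periodic _ k0) -/h; apply: small; rewrite /r in rh *.
by apply/andP; split; lra.
Qed.


Lemma zolo_node_angle k i : (i < k)%N -> 0 <= (2 * i + 1)%:R * V / (2 * k%:R) <= V.
Proof.
move=> ik; have k0R : 0 < k%:R :> R by rewrite ltr0n; lia.
have k2 : 0 < 2 * k%:R :> R by rewrite mulr_gt0.
apply/andP; split; first by rewrite divr_ge0 ?(ltW k2)// mulr_ge0// ltW.
rewrite (ler_pdivrMr _ _ k2) mulrC (ler_pM2l V0).
by rewrite -natrM ler_nat; lia.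
Qed.

Lemma zolo_node_inj k i j : (i < k)%N -> (j < k)%N -> zolo_node k i = zolo_node k j -> i = j.
Proof.
wlog ij : i j / (i < j)%N => [W ik jk E|ik jk E].
  by have [ij|ij|//] := ltngtP i j; [exact: W|apply/esym/W].
have k0R : 0 < k%:R :> R by rewrite ltr0n; lia.
have /andP[i0 _] := zolo_node_angle ik; have /andP[_ jV] := zolo_node_angle jk.
have lt : (2 * i + 1)%:R * V / (2 * k%:R) < (2 * j + 1)%:R * V / (2 * k%:R).
  by rewrite ltr_pM2r ?invr_gt0 ?mulr_gt0// ltr_pM2r// ltr_nat; lia.
by have := dn_decr i0 lt jV; rewrite -/(zolo_node k i) -/(zolo_node k j) E ltxx.
Qed.

Let tau k := zolo_ratio k (V / (4 * k%:R)).

(** The nodes for [2k] lie a quarter step away from the multiples of the period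
    of [zolo_ratio k], which is even and periodic; hence it takes one single value
    at all of them. *)
Lemma zolo_ratio_node2 k j : (0 < k)%N ->
  zolo_ratio k ((2 * j + 1)%:R * V / (2 * (2 * k)%:R)) = tau k.
Proof.
move=> k0; have k0R : k%:R != 0 :> R by rewrite pnatr_eq0 -lt0n.
rewrite [(2 * k)%:R]natrM.
have tE : (V / (4 * k%:R)) = (2 * 0 + 1)%:R * V / (2 * (2 * k%:R)).
  by rewrite natrD natrM; field.
suff : zolo_ratio k ((2 * j + 1)%:R * V / (2 * (2 * k%:R))) = tau k /\
       zolo_ratio k ((2 * j.+1 + 1)%:R * V / (2 * (2 * k%:R))) = tau k by case.
elim: j => [|j [IH1 IH2]]; split=> //.
- by rewrite -tE.
- rewrite /tau -(zolo_ratio_even k (_ / _)) -(zolo_ratio_periodic _ k0).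
  by congr zolo_ratio; rewrite !natrD !natrM; field.
- rewrite -IH1 -[RHS](zolo_ratio_periodic _ k0); congr zolo_ratio.
  by rewrite !natrD !natrM -!natr1; field.
Qed.

Let tau_lt1 k : (0 < k)%N -> 0 <= tau k < 1.
Proof.
move=> k0; rewrite zolo_ratio_ge0/= /tau /zolo_ratio.
rewrite [ltRHS](_ : 1 = \prod_(i < k) (1 : R)); last by rewrite big1.
apply: ltr_prod; first by apply/hasP; exists (Ordinal k0); rewrite ?mem_index_enum.
move=> i _; have h1 := dn_gt0 (V / (4 * k%:R)); have h2 := zolo_node_gt0 k i.
have h3 := addr_gt0 h1 h2.
apply/andP; split; first by rewrite divr_ge0// ltW.
by rewrite ltr_pdivrMr// mul1r ltr_norml; apply/andP; split; lra.
Qed.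

Let zolo_num k : {poly R} := \prod_(i < k) ('X - (zolo_node k i)%:P).
Let zolo_den k : {poly R} := \prod_(i < k) ('X - (- zolo_node k i)%:P).

Let zolo_ratioE k v : zolo_ratio k v = `|(zolo_num k).[dn v]| / (zolo_den k).[dn v].
Proof.
rewrite /zolo_ratio /zolo_num /zolo_den !horner_prod normr_prod -prodf_div.
by apply: eq_bigr => i _; rewrite !hornerE opprK.
Qed.

Let zolo_den_gt0 k v : 0 < (zolo_den k).[dn v].
Proof.
by rewrite horner_prod prodr_gt0// => i _; rewrite !hornerE opprK addr_gt0// zolo_node_gt0.
Qed.

(** Both sides have degree [2k] and the same leading coefficient, and vanish at
    the [2k] nodes: the left one because the ratio for [k] equals [tau k] there. *)
Lemma zolo_num_doubling k : (0 < k)%N ->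
  zolo_num k ^+ 2 - (tau k ^+ 2) *: zolo_den k ^+ 2 = (1 - tau k ^+ 2) *: zolo_num (2 * k).
Proof.
move=> k0; apply/eqP; rewrite -subr_eq0; apply/eqP.
set E := _ - _ - _.
have mon n (u : 'I_n -> R) : exists2 q : {poly R},
    \prod_(i < n) ('X - (u i)%:P) = 'X^n + q & (size q <= n)%N.
  elim: n u => [|n IH] u; first by exists 0; rewrite ?big_ord0 ?addr0 ?size_poly0.
  have [q qE sq] := IH (fun i => u (lift ord0 i)).
  rewrite big_ord_recl qE; exists ('X * q - (u ord0)%:P * ('X^n + q)).
    by rewrite exprS; ring.
  rewrite (leq_trans (size_polyD _ _))// geq_max size_polyN.
  rewrite mulrC (leq_trans (size_polyMleq _ _)) ?size_polyX ?addn2//=.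
  rewrite mul_polyC (leq_trans (size_scale_leq _ _))//.
  rewrite (leq_trans (size_polyD _ _))// geq_max size_polyXn leqnn.
  exact: leqW.
have mon2 (u : 'I_k -> R) : exists2 q : {poly R},
    (\prod_(i < k) ('X - (u i)%:P)) ^+ 2 = 'X^(2 * k) + q & (size q <= 2 * k)%N.
  have [q qE sq] := mon _ (fun i : 'I_(k + k) => match fintype.split i with inl a => u a | inr b => u b end).
  exists q; last by rewrite mul2n -addnn.
  rewrite mul2n -addnn -qE expr2 big_split_ord /=; congr (_ * _); apply: eq_bigr => i _.
    by rewrite (unsplitK (inl i)).
  by rewrite (unsplitK (inr i)).
apply: (@roots_geq_poly_eq0 _ E [seq zolo_node (2 * k) i | i <- iota 0 (2 * k)]).
- apply/allP => x /mapP [l + ->]; rewrite mem_iota add0n /= => lk.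
  rewrite rootE /E !hornerD !hornerN !hornerZ !horner_exp.
  have -> : (zolo_num (2 * k)).[zolo_node (2 * k) l] = 0.
    by rewrite horner_prod (bigD1 (Ordinal lk))//= !hornerE subrr mul0r.
  have := zolo_ratio_node2 l k0; rewrite zolo_ratioE -/(zolo_node _ _) => t.
  have tE : tau k * (zolo_den k).[zolo_node (2 * k) l] = `|(zolo_num k).[zolo_node (2 * k) l]|.
    by rewrite -t divfK// gt_eqF// zolo_den_gt0.
  by rewrite mulr0 subr0 -exprMn tE real_normK ?num_real// subrr.
- rewrite map_inj_in_uniq ?iota_uniq// => i j; rewrite !mem_iota !add0n /=.
  exact: zolo_node_inj.
rewrite size_map size_iota.
have [q1 E1 s1] := mon2 (fun i => zolo_node k i).
have [q2 E2 s2] := mon2 (fun i => - zolo_node k i).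
have [q3 E3 s3] := mon _ (fun i : 'I_(2 * k) => zolo_node (2 * k) i).
have -> : E = q1 - (tau k ^+ 2) *: q2 - (1 - tau k ^+ 2) *: q3.
  by rewrite /E /zolo_num /zolo_den E1 E2 E3 -!mul_polyC polyCB polyC1; ring.
rewrite (leq_trans (size_polyD _ _))// geq_max size_polyN.
rewrite (leq_trans (size_polyD _ _)) ?geq_max ?size_polyN ?s1//=.
  by rewrite (leq_trans (size_scale_leq _ _)).
by rewrite (leq_trans (size_scale_leq _ _)).
Qed.


(** As rational functions, the ratio for [2k] is
    [(s^2 - t^2)/(1 - t^2 s^2)] in terms of the ratio [s] for [k]. Where [s]
    vanishes its absolute value is [t^2], and at [v] it is at least
    [s^2 - t^2]; one of the two is at least [s^2/2]. *)
Lemma zolo_ratio_doubling k v : (0 < k)%N ->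
  exists v', zolo_ratio k v ^+ 2 / 2 <= zolo_ratio (2 * k) v'.
Proof.
move=> k0; pose x := dn v.
pose n := (zolo_num k).[x]; pose d := (zolo_den k).[x].
have d0 : 0 < d by exact: zolo_den_gt0.
have /andP[t0 t1] := tau_lt1 k0.
have t21 : 0 < 1 - tau k ^+ 2 by rewrite subr_gt0 expr_lt1.
have zolo_den_opp j y : (zolo_den j).[y] = (-1) ^+ j * (zolo_num j).[- y].
  rewrite !horner_prod -[X in _ ^+ X](card_ord j) -prodr_const -big_split/=.
  by apply: eq_bigr => i _; rewrite !hornerE; ring.
have zolo_num_opp j y : (zolo_den j).[- y] = (-1) ^+ j * (zolo_num j).[y].
  by rewrite zolo_den_opp opprK.
have hN y : (zolo_num k).[y] ^+ 2 - tau k ^+ 2 * (zolo_den k).[y] ^+ 2 =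
    (1 - tau k ^+ 2) * (zolo_num (2 * k)).[y].
  have /(congr1 (horner^~ y)) := zolo_num_doubling k0.
  by rewrite !hornerD !hornerN !hornerZ !horner_exp.
have hD : d ^+ 2 - tau k ^+ 2 * n ^+ 2 = (1 - tau k ^+ 2) * (zolo_den (2 * k)).[x].
  have e1 : (zolo_num k).[- x] ^+ 2 = d ^+ 2 by rewrite /d zolo_den_opp exprMn sqrr_sign mul1r.
  have e2 : (zolo_den k).[- x] ^+ 2 = n ^+ 2 by rewrite zolo_num_opp exprMn sqrr_sign mul1r.
  have e3 : (zolo_den (2 * k)).[x] = (zolo_num (2 * k)).[- x].
    by rewrite zolo_den_opp mulnC exprM sqrr_sign mul1r.
  by rewrite e3 -hN e1 e2.
set s := zolo_ratio k v; have sE : s * d = `|n| by rewrite /s zolo_ratioE divfK// gt_eqF.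
have s0 : 0 <= s by exact: zolo_ratio_ge0.
have sn : s ^+ 2 * d ^+ 2 = n ^+ 2 by rewrite -exprMn sE real_normK// num_real.
have s2E u : zolo_ratio (2 * k) u =
    `|(1 - tau k ^+ 2) * (zolo_num (2 * k)).[dn u]| / ((1 - tau k ^+ 2) * (zolo_den (2 * k)).[dn u]).
  rewrite zolo_ratioE normrM (gtr0_norm t21) -mulf_div divff ?mul1r//.
  by rewrite gt_eqF.
have [small|large] := leP (s ^+ 2) (2 * tau k ^+ 2).
  exists ((2 * 0 + 1)%:R * V / (2 * k%:R)).
  rewrite (_ : zolo_ratio _ _ = tau k ^+ 2); first by lra.
  rewrite s2E -/(zolo_node k 0); set y := zolo_node k 0.
  have ny : (zolo_num k).[y] = 0.
    by rewrite horner_prod (bigD1 (Ordinal k0))//= !hornerE subrr mul0r.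
  have dy : 0 < (zolo_den k).[y] by exact: zolo_den_gt0.
  have e1 : (zolo_num k).[- y] ^+ 2 = (zolo_den k).[y] ^+ 2.
    by rewrite zolo_den_opp exprMn sqrr_sign mul1r.
  have e2 : (zolo_den k).[- y] ^+ 2 = (zolo_num k).[y] ^+ 2.
    by rewrite zolo_num_opp exprMn sqrr_sign mul1r.
  have e3 : (zolo_den (2 * k)).[y] = (zolo_num (2 * k)).[- y].
    by rewrite zolo_den_opp mulnC exprM sqrr_sign mul1r.
  rewrite e3 -!hN e1 e2 ny expr0n/= mulr0 subr0 sub0r normrN.
  rewrite ger0_norm; last by rewrite mulr_ge0 ?sqr_ge0// exprn_ge0// ltW.
  by rewrite mulfK// sqrf_eq0 gt_eqF.
exists v; rewrite s2E -/x -hN -hD -/n -/d -sn.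
have d20 : 0 < d ^+ 2 by rewrite exprn_gt0.
have -> : `|s ^+ 2 * d ^+ 2 - tau k ^+ 2 * d ^+ 2| = (s ^+ 2 - tau k ^+ 2) * d ^+ 2.
  by rewrite -mulrBl normrM (gtr0_norm d20) ger0_norm//; have := sqr_ge0 (tau k); lra.
have -> : d ^+ 2 - tau k ^+ 2 * (s ^+ 2 * d ^+ 2) = (1 - tau k ^+ 2 * s ^+ 2) * d ^+ 2.
  by ring.
have s1 : s ^+ 2 <= 1.
  rewrite expr_le1// /s /zolo_ratio; apply: prodr_ile1 => i _.
  have h1 := dn_gt0 v; have h2 := zolo_node_gt0 k i; have h3 := addr_gt0 h1 h2.
  apply/andP; split; first by rewrite divr_ge0// ltW.
  by rewrite ler_pdivrMr// mul1r ler_norml; apply/andP; split; lra.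
have ts : 0 <= tau k ^+ 2 * s ^+ 2 by rewrite mulr_ge0// sqr_ge0.
have ts1 : tau k ^+ 2 * s ^+ 2 <= tau k ^+ 2 by rewrite ler_piMr// sqr_ge0.
have b0 : 0 < 1 - tau k ^+ 2 * s ^+ 2 by lra.
rewrite -mulf_div divff ?gt_eqF// mulr1 ler_pdivlMr//.
have := mulr_ge0 (sqr_ge0 s) ts; have := sqr_ge0 (tau k); lra.
Qed.

(** Halving absorbs the factor of the doubling step:
    [(s_k/2)^2 <= s_(2k)/2] at a suitable argument. *)
Theorem zolo_ratio_iter k v N : (0 < k)%N ->
  (zolo_ratio k v / 2) ^+ (2 ^ N) <=
  (\prod_(i < 2 ^ N * k) ph (i.+1%:R * V / (2 ^ N * k)%:R)) / 2.
Proof.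
elim: N k v => [|N IH] k v k0.
  by rewrite expn0 expr1 mul1n ler_pM2r ?invr_gt0//; exact: zolo_ratio_le.
have [v' hv'] := zolo_ratio_doubling v k0.
have k20 : (0 < 2 * k)%N by rewrite muln_gt0.
have := IH _ v' k20; have -> : (2 ^ N * (2 * k) = 2 ^ N.+1 * k)%N by rewrite expnSr mulnA.
apply: le_trans; rewrite expnS exprM; apply: lerXn2r.
- by rewrite nnegrE sqr_ge0.
- by rewrite nnegrE divr_ge0// zolo_ratio_ge0.
by rewrite expr_div_n; lra.
Qed.
End Zolotarev.

(** * Integrals over open intervals *)

Section ImproperIntegral.
Context {R : realType}.
Local Open Scope classical_set_scope.
Local Notation mu := (@lebesgue_measure R).
Implicit Types (f G : R -> R) (a b c d : R).

Lemma measurable_fun_oo f a b :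
  (forall x, a < x < b -> {for x, continuous f}) ->
  measurable_fun (`]a, b[ : set R) (fun x => (f x)%:E).
Proof.
move=> cf; apply/measurable_EFinP; apply: open_continuous_measurable_fun => //.
by move=> x; rewrite inE/= in_itv/= => /cf.
Qed.

Lemma integral_oo_ge f a b c d :
  (forall x, a < x < b -> {for x, continuous f}) ->
  (forall x, a < x < b -> 0 <= f x) -> a < c -> d < b ->
  (\int[mu]_(x in `[c, d]) (f x)%:E <= \int[mu]_(x in `]a, b[) (f x)%:E)%E.
Proof.
move=> cf f0 ac db; apply: ge0_subset_integral => //.
- exact: measurable_fun_oo.
move=> x /=; rewrite !in_itv/= => /andP[cx xd].
by rewrite (lt_le_trans ac)//= (le_lt_trans xd).
Qed.

(** Monotone convergence along compact subintervals. It lets improper integrals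
    be handled through the fundamental theorem on compact intervals only. *)
Lemma integral_oo_le f a b (C : \bar R) : a < b ->
  (forall x, a < x < b -> {for x, continuous f}) ->
  (forall x, a < x < b -> 0 <= f x) ->
  (forall c d, a < c -> c < d -> d < b ->
     (\int[mu]_(x in `[c, d]) (f x)%:E <= C)%E) ->
  (\int[mu]_(x in `]a, b[) (f x)%:E <= C)%E.
Proof.
move=> ab cf f0 fC.
(* [n.+3] keeps both ends strictly inside and in order from [n = 0] on. *)
pose e (n : nat) := (b - a) / n.+3%:R.
have e0 n : 0 < e n by rewrite divr_gt0 ?subr_gt0.
have e3 n : 3 * e n <= b - a.
  by rewrite /e mulrA ler_pdivrMr// mulrC ler_pM2l ?subr_gt0// ler_nat.
have en m n : (m <= n)%N -> e n <= e m.
  move=> mn; rewrite /e ler_pM2l ?subr_gt0// lef_pV2 ?posrE//.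
  by rewrite ler_nat !ltnS.
pose D n : set R := `[a + e n, b - e n].
pose g (n : nat) : R -> \bar R := (fun x => (f x)%:E) \_ (D n).
have DD n : D n `<=` `]a, b[.
  move=> x; rewrite /D /= !in_itv/= => /andP[h1 h2]; have := e0 n.
  by move=> h3; apply/andP; split; lra.
have g0 n x : `]a, b[ x -> (0 <= g n x)%E.
  by move=> xab; rewrite /g patchE; case: ifPn => // _; rewrite lee_fin f0//; move: xab; rewrite /= in_itv.
have mg n : measurable_fun (`]a, b[ : set R) (g n).
  rewrite /g; apply/measurable_restrict; [exact: measurable_itv|exact: measurable_itv|].
  apply: measurable_funS (measurable_fun_oo cf); first exact: measurable_itv.
  by move=> x [].
have ndg x : `]a, b[ x -> {homo g ^~ x : n m / (n <= m)%N >-> (n <= m)%E}.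
  move=> xab m n mn; rewrite /g !patchE; case: ifPn => [|_]; last first.
    by case: ifPn => // _; rewrite lee_fin f0//; move: xab; rewrite /= in_itv.
  rewrite inE /D /= in_itv/= => /andP[h1 h2]; rewrite ifT// inE/= in_itv/=.
  by have := en _ _ mn => h3; apply/andP; split; lra.
have limg x : `]a, b[ x -> limn (g ^~ x) = (f x)%:E.
  rewrite /= in_itv/= => /andP[ax xb].
  apply: lim_near_cst => //.
  pose r := Num.min (x - a) (b - x).
  have r0 : 0 < r by rewrite lt_min !subr_gt0 ax xb.
  have ba : 0 <= (b - a) / r by rewrite divr_ge0 ?subr_ge0 ?ltW.
  have /andP[_ hN] := truncn_itv ba.
  exists (Num.truncn ((b - a) / r)) => // n /= Nn.
  have enr : e n <= r.
    rewrite /e ler_pdivrMr//; rewrite ltr_pdivrMr// in hN.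
    rewrite mulrC (le_trans (ltW hN))// ler_pM2r// ler_nat; lia.
  rewrite /g patchE ifT// inE /D /= in_itv/=.
  have : r <= x - a by rewrite ge_min lexx.
  have : r <= b - x by rewrite ge_min lexx orbT.
  by move=> h1 h2; apply/andP; split; lra.
have -> : (\int[mu]_(x in `]a, b[) (f x)%:E =
           \int[mu]_(x in `]a, b[) limn (g ^~ x))%E.
  by apply: eq_integral => x; rewrite inE => xab; rewrite limg.
rewrite monotone_convergence//.
apply: lime_le.
  apply: ereal_nondecreasing_is_cvgn => m n mn.
  apply: ge0_le_integral; [exact: measurable_itv|exact: g0|exact: (mg m)|exact: (mg n)|by move=> x xab; exact: ndg].
apply: nearW => n; rewrite -integral_mkcondr (_ : _ `&` _ = D n); last first.
  by apply: setIidr; exact: DD.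
have := e0 n; have := e3 n => h1 h2.
by apply: fC; lra.
Qed.

Lemma integral_FTC f G a b c d :
  (forall x, a < x < b -> {for x, continuous f}) ->
  (forall x : R, a < x < b -> is_derive x 1 G (f x)) ->
  a < c -> c < d -> d < b ->
  (\int[mu]_(x in `[c, d]) (f x)%:E = (G d - G c)%:E)%E.
Proof.
move=> cf dG ac cd db.
have sub x : x \in `[c, d]%R -> a < x < b.
  by rewrite in_itv/= => /andP[cx xd]; rewrite (lt_le_trans ac)//= (le_lt_trans xd).
have cG x : x \in `[c, d]%R -> {for x, continuous G}.
  by move=> /sub/dG [dx _]; apply/differentiable_continuous/derivable1_diffP.
rewrite (@continuous_FTC2 _ f G c d)//.
- apply: continuous_in_subspaceT => x; rewrite inE/= => /sub; exact: cf.
- split.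
  + by move=> x /subset_itv_oo_cc /sub/dG [].
  + by apply/cvg_at_right_filter/cG; rewrite in_itv/= lexx ltW.
  + by apply/cvg_at_left_filter/cG; rewrite in_itv/= lexx ltW.
- by move=> x /subset_itv_oo_cc /sub/dG [_]; rewrite derive1E.
Qed.
End ImproperIntegral.

(** * The complete elliptic integral in Legendre form *)

Section LegendreIntegrand.
Context {R : realType} (m : R) (m0 : 0 <= m) (m1 : m < 1).

(** Integrand of the complete elliptic integral of parameter [m], the square of
    the modulus. *)
Definition legendre (t : R) : R := (Num.sqrt ((1 - t ^+ 2) * (1 - m * t ^+ 2)))^-1.

Lemma legendre_ge0 (t : R) : 0 <= legendre t.
Proof. by rewrite invr_ge0 sqrtr_ge0. Qed.

Lemma legendre_factors (t : R) : 0 < t < 1 -> 0 < 1 - t ^+ 2 /\ 0 < 1 - m * t ^+ 2.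
Proof.
move=> /andP[t0 t1].
have h : t ^+ 2 < 1 by rewrite expr_lt1// ltW.
have h2 := sqr_ge0 t; split; first by rewrite subr_gt0.
by rewrite subr_gt0 (le_lt_trans _ m1)// ler_piMr// ltW.
Qed.

Lemma continuous_legendre (t : R) : 0 < t < 1 -> {for t, continuous legendre}.
Proof.
move=> /legendre_factors[h1 h2]; apply: cvgV; first by rewrite gt_eqF// sqrtr_gt0 mulr_gt0.
apply: continuous_comp; last exact: sqrt_continuous.
apply: cvgM; apply: cvgB; try exact: cvg_cst.
  by rewrite expr2; apply: cvgM; exact: cvg_id.
by apply: cvgM; [exact: cvg_cst|rewrite expr2; apply: cvgM; exact: cvg_id].
Qed.
End LegendreIntegrand.

Section EllipticIntegral.
Context {R : realType} (m : R) (m0 : 0 <= m) (m1 : m < 1).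
Context (F am : R -> R) (Fam : is_amplitude m F am).
Local Open Scope classical_set_scope.
Local Notation mu := (@lebesgue_measure R).

Let V := F (pi / 2).
Let dF (t : R) : is_derive t 1 F (Delta m t)^-1. Proof. by case: Fam. Qed.
Let F0 : F 0 = 0. Proof. by case: Fam. Qed.
Let FK : cancel F am. Proof. by case: Fam. Qed.
Let amK : cancel am F. Proof. by case: Fam. Qed.
Let V0 : 0 < V. Proof. exact: (half_period_gt0 m0 m1 Fam). Qed.
Let am0 : am 0 = 0. Proof. exact: (am0 Fam). Qed.
Let amV : am V = pi / 2. Proof. exact: FK. Qed.
Let am_lt (x y : R) : x < y -> am x < am y. Proof. exact: (am_lt m0 m1 Fam). Qed.
Let F_lt (x y : R) : x < y -> F x < F y. Proof. exact: (ell_increasing m0 m1 Fam). Qed.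
Let F_le (x y : R) : x <= y -> F x <= F y.
Proof. by rewrite le_eqVlt => /predU1P[->//|/F_lt/ltW]. Qed.

(** The substitution [t = sin phi]. The antiderivative [F (asin t)] gives the
    value on compact subintervals; their supremum is [F (pi/2)] by inversion of
    [F], so no limit at the singular end point is needed. *)
Lemma ellipticK_integral :
  (\int[mu]_(t in `]0%R, 1%R[) (legendre m t)%:E = V%:E)%E.
Proof.
pose f := legendre m; pose G := F \o (@asin R).
have f0 (t : R) : 0 < t < 1 -> 0 <= f t by move=> _; exact: legendre_ge0.
have cf (t : R) : 0 < t < 1 -> {for t, continuous f}.
  by move=> t01; exact: continuous_legendre.
have dG (t : R) : 0 < t < 1 -> is_derive t 1 G (f t).
  move=> t01; have [h1 h2] := legendre_factors m0 m1 t01.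
  have t11 : -1 < t < 1 by case/andP: t01 => *; apply/andP; split; lra.
  have t11' : -1 <= t <= 1 by case/andP: t01 => *; apply/andP; split; lra.
  have da := is_derive1_asin t11; have h := dF (asin t).
  apply: is_derive_eq; rewrite /Delta asinK ?in_itv//= /f /legendre.
  by rewrite sqrtrM ?(ltW h1)// invfM mulrC.
have asin0 (t : R) : 0 < t < 1 -> 0 <= asin t <= pi / 2.
  move=> /andP[h1 h2]; have t11 : -1 <= t <= 1 by apply/andP; split; lra.
  rewrite asin_lepi2// andbT leNgt; apply/negP => lt0.
  have p0 := @pi_gt0 R; have hl := asin_geNpi2 t11.
  have : 0 <= sin (- asin t) by apply: sin_ge0_pi; apply/andP; split; lra.
  by rewrite sinN asinK ?in_itv//=; lra.
rewrite -/(f _); set I := (\int[mu]_(t in _) _)%E.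
have IV : (I <= V%:E)%E.
  apply: (integral_oo_le ltr01 cf f0) => c d c0 cd d1.
  rewrite (integral_FTC cf dG)// lee_fin /G /=.
  have /asin0/andP[_ hd] : 0 < d < 1 by rewrite d1 (lt_trans c0).
  have /asin0/andP[hc _] : 0 < c < 1 by rewrite c0 (lt_trans cd).
  have := F_le hd; have := F_le hc; rewrite F0 -/V; lra.
have I0 : (0%E <= I)%E by apply: integral_ge0 => t /=; rewrite in_itv/= lee_fin => /f0.
have IE : I = (fine I)%:E.
  by rewrite fineK// ge0_fin_numE// (le_lt_trans IV)// ltry.
apply/eqP; rewrite eq_le IV /= leNgt; apply/negP; rewrite IE lte_fin => rV.
(* If the integral were smaller than [V], the subinterval from [am e] to
   [am (V - e)] would already contribute [V - 2 e], which is larger. *)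
pose e := (V - fine I) / 4; have r0 : 0 <= fine I by rewrite -lee_fin -IE.
have e0 : 0 < e by rewrite divr_gt0// subr_gt0.
have eV : 4 * e = V - fine I by rewrite /e mulrC divfK.
have a1 : am 0 < am e by exact: am_lt.
have a2 : am e < am (V - e) by apply: am_lt; lra.
have a3 : am (V - e) < am V by apply: am_lt; lra.
rewrite am0 in a1; rewrite amV in a3; have p0 := @pi_gt0 R.
have sc : 0 < sin (am e) by apply: sin_gt0_pi; apply/andP; split; lra.
have scd : sin (am e) < sin (am (V - e)).
  by rewrite ltr_sin// in_itv/=; apply/andP; split; lra.
have sd : sin (am (V - e)) < 1.
  by rewrite -sin_pihalf ltr_sin// in_itv/=; apply/andP; split; lra.
have := integral_oo_ge cf f0 sc sd; rewrite (integral_FTC cf dG)// -/I IE lee_fin.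
rewrite /G /= !sinK ?in_itv/= ?amK; [|by apply/andP; split; lra|by apply/andP; split; lra].
lra.
Qed.
End EllipticIntegral.

(** * Riemann sums of the logarithm of dnratio *)

Section EllipticRiemannSum.
Context {R : realType} (m : R) (m0 : 0 < m) (m1 : m < 1).
Context (F am : R -> R) (Fam : is_amplitude m F am).
Local Open Scope classical_set_scope.
Local Notation mu := (@lebesgue_measure R).

Let m0' : 0 <= m. Proof. exact: ltW. Qed.
Let V := F (pi / 2).
Let dF (t : R) : is_derive t 1 F (Delta m t)^-1. Proof. by case: Fam. Qed.
Let F0 : F 0 = 0. Proof. by case: Fam. Qed.
Let FK : cancel F am. Proof. by case: Fam. Qed.
Let amK : cancel am F. Proof. by case: Fam. Qed.
Let dam (v : R) : is_derive v 1 am (Delta m (am v)). Proof. by case: Fam. Qed.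
Let V0 : 0 < V. Proof. exact: (half_period_gt0 m0' m1 Fam). Qed.
Let am0 : am 0 = 0. Proof. exact: (am0 Fam). Qed.
Let amV : am V = pi / 2. Proof. exact: FK. Qed.
Let am_lt (x y : R) : x < y -> am x < am y. Proof. exact: (am_lt m0' m1 Fam). Qed.
Let am_le (x y : R) : x <= y -> am x <= am y.
Proof. by rewrite le_eqVlt => /predU1P[->//|/am_lt/ltW]. Qed.

(** Density of [- log (dnratio)] with respect to the amplitude: the differential of
    the argument of [dn] is that of the amplitude divided by [Delta]. *)
Definition loggap (t : R) : R := ln ((1 + Delta m t) / (1 - Delta m t)) / Delta m t.

Lemma Delta_lt1 (t : R) : 0 < t < pi -> Delta m t < 1.
Proof.
move=> t0; rewrite -[ltRHS]sqrtr1 ltr_sqrt// ltrBlDr ltrDl mulr_gt0// exprn_gt0//.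
exact: sin_gt0_pi.
Qed.

Lemma continuous_loggap (t : R) : 0 < t < pi -> {for t, continuous loggap}.
Proof.
move=> t0; have d1 := Delta_lt1 t0; have d0 := Delta_gt0 m0' m1 t.
have cD : {for t, continuous (Delta m)} by exact: continuous_Delta.
apply: cvgM; last by apply: cvgV; [rewrite gt_eqF|exact: cD].
apply: continuous_comp; last first.
  by apply: continuous_ln; rewrite divr_gt0 ?subr_gt0// addr_gt0.
apply: cvgM; first by apply: cvgD; [exact: cvg_cst|exact: cD].
apply: cvgV; first by rewrite gt_eqF// subr_gt0.
by apply: cvgB; [exact: cvg_cst|exact: cD].
Qed.

Lemma loggap_ge0 (t : R) : 0 < t < pi -> 0 <= loggap t.
Proof.
move=> t0; have d1 := Delta_lt1 t0; have d0 := Delta_gt0 m0' m1 t.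
rewrite divr_ge0 ?(ltW d0)// ln_ge0// ler_pdivlMr ?subr_gt0// mul1r; lra.
Qed.

Let dn_lt1 (v : R) : 0 < v -> v <= V -> dn m am v < 1.
Proof.
move=> v0 vV; have p0 := @pi_gt0 R; apply: Delta_lt1.
have := am_lt v0; have := am_le vV; rewrite am0 amV => h1 h2.
by apply/andP; split; lra.
Qed.

Let ph v := dnratio m am v.

Let ph_gt0 (v : R) : 0 < v -> v <= V -> 0 < ph v.
Proof.
move=> v0 vV; have h := dn_lt1 v0 vV; have h2 := dn_gt0 m0' m1 am v.
by rewrite divr_gt0 ?subr_gt0// addr_gt0.
Qed.

Let ph_le (x y : R) : 0 < x -> x <= y -> y <= V -> ph x <= ph y.
Proof.
move=> x0; rewrite le_eqVlt => /predU1P[->//|xy] yV.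
have h := dn_decreasing m0' m1 Fam m0 (ltW x0) xy yV.
have h1 := dn_gt0 m0' m1 am x; have h2 := dn_gt0 m0' m1 am y.
rewrite /ph /dnratio ler_pdivrMr ?addr_gt0// mulrAC ler_pdivlMr ?addr_gt0//.
nra.
Qed.

(** On each step [- log (dnratio)] is largest at the left end, and in the argument
    of [dn] all steps have length [V/M]; summing bounds the integral of [loggap]
    by the Riemann sum. *)
Lemma loggap_integral_le (M : nat) (c d : R) : (0 < M)%N ->
  am (V / M%:R) <= c -> c < d -> d < pi / 2 ->
  (\int[mu]_(t in `[c, d]) (loggap t)%:E <=
   (V / M%:R * \sum_(i < M) - ln (ph (i.+1%:R * V / M%:R)))%:E)%E.
Proof.
move=> M0; set h := V / M%:R; set c0 := am h => c0c cd dp.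
have p0 := @pi_gt0 R.
have MR : 0 < M%:R :> R by rewrite ltr0n.
have h0 : 0 < h by rewrite divr_gt0.
have hV : h <= V by rewrite ler_pdivrMr// ler_peMr ?(ltW V0)// ler1n.
have c00 : 0 < c0 by rewrite /c0 -am0 am_lt.
have c0p : c0 <= pi / 2 by rewrite -amV /c0 am_le.
(* Clipping to [[c0, pi/2]] makes [loggap] continuous on the whole line, so that
   it has an antiderivative there. *)
pose clip (t : R) : R := Num.max c0 (Num.min t (pi / 2)).
have clip_in t : c0 <= clip t <= pi / 2.
  by rewrite /clip le_max lexx/= ge_max c0p ge_min lexx orbT.
have clip_pi t : 0 < clip t < pi.
  by have /andP[? ?] := clip_in t; apply/andP; split; lra.
have clipE t : c0 <= t <= pi / 2 -> clip t = t.
  by move=> /andP[h1 h2]; rewrite /clip (min_l h2) (max_r h1).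
have cclip : continuous clip.
  have cmin : continuous (id \min (cst (pi / 2) : R -> R^o)).
    by move=> t; apply: continuous_min; [exact: cvg_id|exact: cst_continuous].
  have cmax : continuous ((cst c0 : R -> R^o) \max (id \min (cst (pi / 2) : R -> R^o))).
    by move=> t; apply: continuous_max; [exact: cst_continuous|exact: cmin].
  exact: cmax.
have cL : continuous (loggap \o clip).
  by move=> t; apply: continuous_comp; [exact: cclip|exact: continuous_loggap].
have [G dG] := continuous_antiderivative cL.
have Gle (x y : R) : x <= y -> G x <= G y.
  move=> xy; rewrite -subr_ge0; have H := @MVT_segment R G (loggap \o clip) x y xy.
  have H1 : {within `[x, y], continuous G}.
    exact/continuous_subspaceT/(derive_continuous dG).
  have [z _ ->] := H (fun z _ => dG z) H1.
  by rewrite mulr_ge0 ?subr_ge0// loggap_ge0.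
have -> : (\int[mu]_(t in `[c, d]) (loggap t)%:E =
           \int[mu]_(t in `[c, d]) ((loggap \o clip) t)%:E)%E.
  apply: eq_integral => t; rewrite inE/= in_itv/= => /andP[t1 t2].
  by rewrite /= clipE//; apply/andP; split; lra.
have cL' (x : R) : c - 1 < x < d + 1 -> {for x, continuous (loggap \o clip)}.
  by move=> _; exact: cL.
have dG' (x : R) : c - 1 < x < d + 1 -> is_derive x 1 G ((loggap \o clip) x).
  by move=> _; exact: dG.
have c1 : c - 1 < c by rewrite ltrBlDr ltrDl.
have dd1 : d < d + 1 by rewrite ltrDl.
rewrite (integral_FTC cL' dG' c1 cd dd1) lee_fin.
pose K v := G (am v).
have dK (v : R) : is_derive v 1 K (loggap (clip (am v)) * Delta m (am v)).
  have h1 := dam v; have h2 := dG (am v).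
  have -> : K = G \o am by apply/funext.
  exact: is_derive1_comp.
have step i : (0 < i)%N -> (i < M)%N ->
    K (i.+1%:R * h) - K (i%:R * h) <= h * - ln (ph (i%:R * h)).
  move=> i0 iM; have ih : i%:R * h <= i.+1%:R * h by rewrite ler_pM2r// ler_nat.
  have iR : 1 <= i%:R :> R by rewrite ler1n.
  have iV : i.+1%:R * h <= V.
    by rewrite /h mulrCA ger_pMr// ler_pdivrMr// mul1r ler_nat.
  have H := @MVT_segment R K (fun v => loggap (clip (am v)) * Delta m (am v)) _ _ ih.
  have H1 : {within `[i%:R * h, i.+1%:R * h], continuous K}.
    exact/continuous_subspaceT/(derive_continuous dK).
  have [z] := H (fun z _ => dK z) H1.
  rewrite in_itv/= => /andP[z1 z2] ->.
  have -> : i.+1%:R * h - i%:R * h = h by rewrite -natr1; ring.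
  rewrite mulrC.
  have hih : h <= i%:R * h by rewrite ler_peMl// ltW.
  have zV : z <= V by exact: le_trans iV.
  have z0 : 0 < z by lra.
  rewrite ler_pM2l// clipE; last first.
    by rewrite /c0 -amV !am_le//; lra.
  rewrite /loggap divfK ?gt_eqF ?Delta_gt0//.
  have d1 := dn_lt1 z0 zV; have d0 := dn_gt0 m0' m1 am z.
  have ihp : 0 < i%:R * h by lra.
  have pz := ph_gt0 z0 zV; have pi0 := ph_gt0 ihp (le_trans z1 zV).
  have -> : (1 + Delta m (am z)) / (1 - Delta m (am z)) = (ph z)^-1.
    by rewrite /ph /dnratio invf_div.
  rewrite lnV ?posrE// lerN2 ler_ln ?posrE//; exact: ph_le.
have sum_step n : (n < M)%N ->
    K (n.+1%:R * h) - K h <= h * \sum_(i < n) - ln (ph (i.+1%:R * h)).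
  elim: n => [|n IH] nM; first by rewrite mul1r subrr big_ord0 mulr0.
  have := IH (ltnW nM); have := step _ (ltn0Sn n) nM.
  by rewrite big_ord_recr/= mulrDr; lra.
have MP : M = M.-1.+1 by rewrite prednK.
have := sum_step M.-1; rewrite -MP leqnn => /(_ isT).
have -> : M%:R * h = V by rewrite /h mulrC divfK// gt_eqF.
have E : \sum_(i < M) - ln (ph (i.+1%:R * V / M%:R)) =
   \sum_(i < M.-1) - ln (ph (i.+1%:R * h)) - ln (ph V).
  rewrite [in LHS]MP big_ord_recr/= -MP; congr (_ + _).
    by apply: eq_bigr => i _; rewrite /h mulrA.
  by rewrite mulrAC divff ?mul1r// gt_eqF.
have phV : ln (ph V) <= 0.
  rewrite -ln1 ler_ln ?posrE ?ph_gt0//.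
  have d0 := dn_gt0 m0' m1 am V.
  by rewrite /ph /dnratio ler_pdivrMr ?addr_gt0// mul1r; lra.
rewrite E mulrBr /K amV -/c0 => hh.
have := Gle _ _ c0c; have := Gle _ _ (ltW dp).
have : h * ln (ph V) <= 0 by rewrite mulr_ge0_le0// ltW.
lra.
Qed.

(** The first step of a Riemann sum, which contains the logarithmic singularity,
    shrinks to a point as [M] grows. *)
Lemma loggap_integral_bound (C : R) :
  (forall N : nat, exists2 M : nat, (N <= M)%N &
     V / M%:R * \sum_(i < M) - ln (ph (i.+1%:R * V / M%:R)) <= C) ->
  (\int[mu]_(t in `]0%R, (pi / 2)%R[) (loggap t)%:E <= C%:E)%E.
Proof.
move=> hC; have p0 := @pi_gt0 R; have p20 : 0 < pi / 2 :> R by rewrite divr_gt0.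
have lt_pi (x : R) : 0 < x < pi / 2 -> 0 < x < pi.
  by move=> /andP[h1 h2]; apply/andP; split; lra.
apply: integral_oo_le p20 _ _ _ => [x /lt_pi|x /lt_pi|c d c0 cd dp].
- exact: continuous_loggap.
- exact: loggap_ge0.
have Fc : 0 < F c by rewrite -F0; apply: (ell_increasing m0' m1 Fam).
have [M NM hM] := hC (Num.truncn (V / F c)).+1.
have M0 : (0 < M)%N by exact: leq_trans NM.
have MR : 0 < M%:R :> R by rewrite ltr0n.
have VF : 0 <= V / F c by rewrite divr_ge0// ltW.
have /andP[_ hN] := truncn_itv VF.
have VM : V / M%:R <= F c.
  rewrite ler_pdivrMr// mulrC -ler_pdivrMr//.
  by rewrite (le_trans (ltW hN))// ler_nat.
have cM : am (V / M%:R) <= c by rewrite -[leRHS]FK am_le.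
by apply: le_trans (loggap_integral_le M0 cM cd dp) _; rewrite lee_fin.
Qed.
End EllipticRiemannSum.

(** * The double integral *)

Section Tonelli.
Context {R : realType} (m : R) (m0 : 0 < m) (m1 : m < 1).
Local Open Scope classical_set_scope.
Local Notation mu := (@lebesgue_measure R).
Let m0' : 0 <= m. Proof. exact: ltW. Qed.

(** Its integral over [y] in [[0, 1]] is [loggap t], and its integral over
    [t] in [[0, pi/2]] is [pi] times a Legendre integrand: the two ways to
    integrate it link the mean of [log (dnratio)] to a complete elliptic
    integral. *)
Definition gap_kernel (t y : R) : R := 2 * (1 - y ^+ 2 * Delta m t ^+ 2)^-1.

Let denom_gt0 (t y : R) : 0 < y < 1 -> 0 < 1 - y ^+ 2 * Delta m t ^+ 2.
Proof.
move=> /andP[y0 y1]; have d0 := Delta_gt0 m0' m1 t; have d1 := Delta_le1 m0' t.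
have h1 : y ^+ 2 < 1 by rewrite expr_lt1// ltW.
have h2 : Delta m t ^+ 2 <= 1 by rewrite expr_le1// ltW.
by rewrite subr_gt0 (le_lt_trans _ h1)// ler_piMr// sqr_ge0.
Qed.

Lemma gap_kernel_ge0 (t y : R) : 0 < y < 1 -> 0 <= gap_kernel t y.
Proof. by move=> h; rewrite mulr_ge0// invr_ge0 ltW// denom_gt0. Qed.

Lemma gap_kernel_continuous (t y : R) : 0 < y < 1 ->
  {for t, continuous (gap_kernel ^~ y)}.
Proof.
move=> y01; apply: cvgM; first exact: cvg_cst.
apply: cvgV; first by rewrite gt_eqF// denom_gt0.
apply: cvgB; first exact: cvg_cst.
apply: cvgM; first exact: cvg_cst.
by rewrite expr2; apply: cvgM; exact: continuous_Delta.
Qed.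

Lemma gap_kernel_integral_le (t : R) : 0 < t < pi / 2 ->
  (\int[mu]_(y in `]0%R, 1%R[) (gap_kernel t y)%:E <= (loggap m t)%:E)%E.
Proof.
move=> /andP[t0 t1]; have p0 := @pi_gt0 R.
have d1 : Delta m t < 1 by apply: (Delta_lt1 m0); apply/andP; split; lra.
have d0 := Delta_gt0 m0' m1 t; rewrite /loggap /gap_kernel.
move: (Delta m t) d0 d1 => D d0 d1.
pose f (y : R) : R := 2 * (1 - y ^+ 2 * D ^+ 2)^-1.
pose G (y : R) : R := D^-1 * (ln (1 + y * D) - ln (1 - y * D)).
have bnd (y : R) : 0 < y < 1 -> [/\ 0 < 1 + y * D, 0 < 1 - y * D & y * D < D].
  move=> /andP[y0 y1]; have h1 : 0 < y * D by rewrite mulr_gt0.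
  have h2 : y * D < D by rewrite gtr_pMl.
  by split; lra.
have fE (y : R) : 1 - y ^+ 2 * D ^+ 2 = (1 + y * D) * (1 - y * D) by ring.
have f0 (y : R) : 0 < y < 1 -> 0 <= f y.
  by move=> /bnd[h1 h2 _]; rewrite mulr_ge0// invr_ge0 fE mulr_ge0// ltW.
have cf (y : R) : 0 < y < 1 -> {for y, continuous f}.
  move=> /bnd[h1 h2 _]; apply: cvgM; first exact: cvg_cst.
  apply: cvgV; first by rewrite fE gt_eqF// mulr_gt0.
  apply: cvgB; first exact: cvg_cst.
  apply: cvgM; last exact: cvg_cst.
  by rewrite expr2; apply: cvgM; exact: cvg_id.
have dG (y : R) : 0 < y < 1 -> is_derive y 1 G (f y).
  move=> /bnd[h1 h2 _].
  pose u1 := cst 1 + D \*: id : R -> R; pose u2 := cst 1 - D \*: id : R -> R.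
  have e1 : u1 y = 1 + y * D by rewrite /u1 !fctE /GRing.scale/= mulrC.
  have e2 : u2 y = 1 - y * D by rewrite /u2 !fctE /GRing.scale/= mulrC.
  have du1 : is_derive y 1 u1 D.
    by apply: is_derive_eq; rewrite /GRing.scale/= mulr1 add0r.
  have du2 : is_derive y 1 u2 (- D).
    by apply: is_derive_eq; rewrite /GRing.scale/= mulr1 sub0r.
  rewrite -e1 in h1; rewrite -e2 in h2.
  have l1 := is_derive1_ln h1; have l2 := is_derive1_ln h2.
  have -> : G = D^-1 \*: ((@ln R \o u1) - (@ln R \o u2)).
    by apply/funext => z; rewrite /G (mulrC z D).
  apply: is_derive_eq; rewrite /f fE -e1 -e2 /GRing.scale/=.
  have n1 : u1 y != 0 by rewrite gt_eqF.
  have n2 : u2 y != 0 by rewrite gt_eqF.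
  have n3 : D != 0 by rewrite gt_eqF.
  have : u1 y + u2 y = 2 by rewrite e1 e2; ring.
  move: (u1 y) (u2 y) n1 n2 => a b n1 n2 ab.
  have -> : 2 * (a * b)^-1 = (a + b) * (a * b)^-1 by rewrite ab.
  by field; rewrite n1 n2 n3.
apply: (integral_oo_le ltr01 cf f0) => c d c0 cd dd1.
rewrite (integral_FTC cf dG c0 cd dd1) lee_fin.
have [c1 c2 c3] : [/\ 0 < 1 + c * D, 0 < 1 - c * D & c * D < D].
  by apply: bnd; rewrite c0 (lt_trans cd).
have [e1 e2 e3] : [/\ 0 < 1 + d * D, 0 < 1 - d * D & d * D < D].
  by apply: bnd; rewrite dd1 (lt_trans c0).
have cD : 0 < c * D by rewrite mulr_gt0.
have Di : 0 < D^-1 by rewrite invr_gt0.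
rewrite /G -mulrBr mulrC ler_pM2r// ln_div ?posrE ?subr_gt0 ?addr_gt0//.
have q1 : 0 < 1 + D by lra.
have q2 : 0 < 1 - D by lra.
have a1 : ln (1 + d * D) <= ln (1 + D) by rewrite ler_ln ?posrE//; lra.
have a2 : ln (1 - D) <= ln (1 - d * D) by rewrite ler_ln ?posrE//; lra.
have a3 : ln (1 - c * D) <= ln (1 + c * D) by rewrite ler_ln ?posrE//; lra.
lra.
Qed.

(** The denominator is [al cos^2 + be sin^2], whose reciprocal has the
    antiderivative [atan (sqrt (be/al) tan t)/sqrt (al be)]. The interval of
    integration is exhausted by end points at which this is explicit. *)
Lemma gap_kernel_integral_ge (y : R) : 0 < y < 1 ->
  ((pi * legendre (1 - m) y)%:E <=
   \int[mu]_(t in `]0%R, (pi / 2)%R[) (gap_kernel t y)%:E)%E.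
Proof.
move=> y01; have p0 := @pi_gt0 R; have /andP[y0 y1] := y01.
have y2 : y ^+ 2 < 1 by rewrite expr_lt1// ltW.
have y20 : 0 < y ^+ 2 by rewrite exprn_gt0.
pose al := 1 - y ^+ 2; pose be := 1 - (1 - m) * y ^+ 2.
have al0 : 0 < al by rewrite subr_gt0.
have be0 : 0 < be.
  by have h := mulr_gt0 m0 y20; rewrite /be; lra.
pose r := Num.sqrt be / Num.sqrt al; pose k := Num.sqrt (al * be).
have sal : 0 < Num.sqrt al by rewrite sqrtr_gt0.
have sbe : 0 < Num.sqrt be by rewrite sqrtr_gt0.
have r0 : 0 < r by rewrite divr_gt0.
have kE : k = Num.sqrt al * Num.sqrt be by rewrite /k sqrtrM// ltW.
have k0 : 0 < k by rewrite kE mulr_gt0.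
have a2 : Num.sqrt al ^+ 2 = al by rewrite sqr_sqrtr// ltW.
have b2 : Num.sqrt be ^+ 2 = be by rewrite sqr_sqrtr// ltW.
rewrite /legendre; pose f := gap_kernel ^~ y.
pose G (t : R) : R := (2 / k) * atan (r * tan t).
have cf (t : R) : 0 < t < pi / 2 -> {for t, continuous f}.
  by move=> _; exact: gap_kernel_continuous.
have f0 (t : R) : 0 < t < pi / 2 -> 0 <= f t.
  by move=> _; exact: gap_kernel_ge0.
have dG (t : R) : 0 < t < pi / 2 -> is_derive t 1 G (f t).
  move=> /andP[t0 t1].
  have ct : 0 < cos t by apply: cos_gt0_pihalf; apply/andP; split; lra.
  have ct0 : cos t != 0 by rewrite gt_eqF.
  have dt := is_derive_tan ct0.
  pose u := r \*: (@tan R).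
  have du : is_derive t 1 u (r * (cos t) ^- 2) by exact: is_deriveZ.
  have da := is_derive1_atan (u t).
  have -> : G = (2 / k) \*: ((@atan R) \o u).
    by apply/funext => z; rewrite /G /u !fctE /GRing.scale/=.
  apply: is_derive_eq; rewrite /f /gap_kernel (sqr_Delta m0' m1) /u /GRing.scale/= /tan.
  have -> : 1 - y ^+ 2 * (1 - m * sin t ^+ 2) = al * cos t ^+ 2 + be * sin t ^+ 2.
    by rewrite cos2sin2 /al /be; ring.
  rewrite -[r *: _]/(r * (sin t / cos t)) /r kE -[in RHS]a2 -[in RHS]b2.
  move: (Num.sqrt al) (Num.sqrt be) sal sbe (cos t) (sin t) ct => a b a0 b0 c s c0.
  have n1 : a != 0 by rewrite gt_eqF.
  have n2 : b != 0 by rewrite gt_eqF.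
  have n3 : c != 0 by rewrite gt_eqF.
  have n4 : a ^+ 2 * c ^+ 2 + b ^+ 2 * s ^+ 2 != 0.
    by rewrite gt_eqF// ltr_pwDl// ?mulr_gt0 ?exprn_gt0// mulr_ge0 ?sqr_ge0.
  by field; rewrite !exprMn n1 n2 n3 n4.
set I := (\int[mu]_(t in _) _)%E; rewrite leNgt; apply/negP => Ilt.
have I0 : (0%E <= I)%E by apply: integral_ge0 => t _; rewrite lee_fin gap_kernel_ge0.
have IE : I = (fine I)%:E.
  by rewrite fineK// ge0_fin_numE// (lt_trans Ilt)// ltry.
have r00 : 0 <= fine I by rewrite -lee_fin -IE.
rewrite IE lte_fin -/al -/be -/k in Ilt.
pose q := fine I * k / 2.
have q0 : 0 <= q by rewrite divr_ge0// mulr_ge0// ltW.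
have qlt : q < pi / 2 by rewrite /q ltr_pM2r ?invr_gt0// -ltr_pdivlMr.
(* Same argument by contradiction: between [c] and [d] the antiderivative grows
   by [(2/k) (pi/2 - 2 e)], which exceeds the assumed value of the integral. *)
pose e := (pi / 2 - q) / 4; have e0 : 0 < e by rewrite divr_gt0// subr_gt0.
have eE : 4 * e = pi / 2 - q by rewrite /e mulrC divfK.
pose c := atan (r^-1 * tan e); pose d := atan (r^-1 * tan (pi / 2 - e)).
have in2 (z : R) : 0 < z -> z < pi / 2 -> z \in `](- (pi / 2)), (pi / 2)[%R.
  by move=> z0 z1; rewrite in_itv/=; apply/andP; split; lra.
have te : 0 < tan e.
  rewrite /tan divr_gt0//; first by apply: sin_gt0_pi; apply/andP; split; lra.
  by apply: cos_gt0_pihalf; apply/andP; split; lra.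
have tt : tan e < tan (pi / 2 - e) by rewrite ltr_tan ?in2//; lra.
have r10 : 0 < r^-1 by rewrite invr_gt0.
have c0 : 0 < c by rewrite -atan0; apply: lt_atan; rewrite mulr_gt0.
have cd : c < d by apply: lt_atan; rewrite ltr_pM2l.
have d1 : d < pi / 2 by exact: atan_ltpi2.
have := integral_oo_ge cf f0 c0 d1; rewrite (integral_FTC cf dG c0 cd d1).
rewrite -/I IE lee_fin /G /c /d !atanK !mulrA !divff ?gt_eqF// !mul1r.
rewrite !tanK ?in2//; try lra.
rewrite -mulrBr mulrAC ler_pdivrMr// -/k => h.
have : 2 * (pi / 2 - e - e) <= 2 * q by rewrite /q [2 * (_ / 2)]mulrC divfK.
lra.
Qed.
End Tonelli.

Section TonelliSwap.
Context {R : realType} (m : R) (m0 : 0 < m) (m1 : m < 1).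
Local Open Scope classical_set_scope.
Local Notation mu := (@lebesgue_measure R).

Lemma loggap_integral_ge :
  (\int[mu]_(y in `]0%R, 1%R[)
     (pi * legendre (1 - m) y)%:E <=
   \int[mu]_(t in `]0%R, (pi / 2)%R[) (loggap m t)%:E)%E.
Proof.
have m0' : 0 <= m by exact: ltW.
pose A : set R := `]0, (pi / 2)%R[; pose B : set R := `]0, 1%R[.
have mA : measurable A by exact: measurable_itv.
have mB : measurable B by exact: measurable_itv.
pose g : R * R -> \bar R := (fun p => (gap_kernel m p.1 p.2)%:E) \_ (A `*` B).
have mg : measurable_fun setT g.
  apply/(measurable_restrictT _ _).1; first exact: measurableX.
  apply/measurable_EFinP.
  pose u (p : R * R) : R := 1 - p.2 ^+ 2 * Delta m p.1 ^+ 2.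
  have mu_ : measurable_fun setT u.
    apply: measurable_funB; first exact: measurable_cst.
    apply: measurable_funM.
      by apply: measurable_funX; exact: measurable_snd.
    apply: measurable_funX; apply: measurableT_comp; last exact: measurable_fst.
    by apply: continuous_measurable_fun; exact: continuous_Delta.
  have mp : measurable_fun (A `*` B) (fun p => 2 * powR (u p) (-1)).
    apply: measurable_funTS; apply: measurable_funM; first exact: measurable_cst.
    exact: (measurableT_comp (measurable_powR _) mu_).
  apply: eq_measurable_fun mp => p; rewrite inE => -[_]; rewrite /B /= in_itv/= => pB.
  have h : gap_kernel m p.1 p.2 = 2 * (u p)^-1 by [].
  rewrite h powR_inv1//.
  have := gap_kernel_ge0 m0 m1 p.1 pB; rewrite h pmulr_rge0// invr_ge0.
  by [].
have g0 p : (0%E <= g p)%E.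
  rewrite /g patchE; case: ifPn => //; rewrite inE => -[_].
  by rewrite /B /= in_itv/= => pB; rewrite lee_fin gap_kernel_ge0.
pose H1 (t : R) : \bar R := (\int[mu]_(y in B) (gap_kernel m t y)%:E)%E.
pose H2 (y : R) : \bar R := (\int[mu]_(t in A) (gap_kernel m t y)%:E)%E.
have E1 (t : R) : (\int[mu]_y g (t, y))%E = (H1 \_ A) t.
  rewrite patchE; case: ifPn => tA.
    rewrite /H1 [RHS]integral_mkcond; apply: eq_integral => y _.
    by rewrite /g !patchE in_setX/= tA.
  by apply: integral0_eq => y _; rewrite /g patchE in_setX/= (negbTE tA).
have E2 (y : R) : (\int[mu]_t g (t, y))%E = (H2 \_ B) y.
  rewrite patchE; case: ifPn => yB.
    rewrite /H2 [RHS]integral_mkcond; apply: eq_integral => t _.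
    by rewrite /g !patchE in_setX/= yB andbT.
  by apply: integral0_eq => t _; rewrite /g patchE in_setX/= (negbTE yB) andbF.
have swap : (\int[mu]_(t in A) H1 t = \int[mu]_(y in B) H2 y)%E.
  rewrite integral_mkcond [RHS]integral_mkcond.
  under eq_integral do rewrite -E1.
  under [RHS]eq_integral do rewrite -E2.
  exact: fubini_tonelli.
have mH1 : measurable_fun A H1.
  apply: (measurable_restrictT H1 mA).2.
  have -> : H1 \_ A = fubini_F mu g by apply/funext => t; rewrite -E1.
  exact: measurable_fun_fubini_tonelli_F.
have mH2 : measurable_fun B H2.
  apply: (measurable_restrictT H2 mB).2.
  have -> : H2 \_ B = fubini_G mu g by apply/funext => t; rewrite -E2.
  exact: measurable_fun_fubini_tonelli_G.
have p0 := @pi_gt0 R.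
have m10 : 0 <= 1 - m by rewrite subr_ge0 ltW.
have m11 : 1 - m < 1 by rewrite ltrBlDr ltrDl.
have Api (t : R) : A t -> 0 < t < pi.
  by rewrite /A/= in_itv/= => /andP[h1 h2]; apply/andP; split; lra.
apply: (@le_trans _ _ (\int[mu]_(y in B) H2 y)%E).
  have mf : measurable_fun B (fun y => (pi * legendre (1 - m) y)%:E).
    apply: measurable_fun_oo => y yB; apply: cvgM; first exact: cvg_cst.
    exact: (continuous_legendre m10 m11 yB).
  have f0 (y : R) : B y -> (0%E <= (pi * legendre (1 - m) y)%:E)%E.
    move=> _; rewrite lee_fin; apply: mulr_ge0; first exact: pi_ge0.
    exact: legendre_ge0.
  apply: ge0_le_integral; [exact: mB|exact: f0|exact: mf|exact: mH2|].
  by move=> y; rewrite /B/= in_itv/= => yB; exact: gap_kernel_integral_ge.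
rewrite -swap.
have H10 (t : R) : A t -> (0%E <= H1 t)%E.
  move=> _; apply: integral_ge0 => y; rewrite /B/= in_itv/= => yB.
  by rewrite lee_fin gap_kernel_ge0.
have mL : measurable_fun A (fun t => (loggap m t)%:E).
  apply: measurable_fun_oo => t tA; apply: continuous_loggap; [exact: m0|exact: m1|].
  by apply: Api; rewrite /A/= in_itv.
apply: ge0_le_integral; [exact: mA|exact: H10|exact: mH1|exact: mL|].
by move=> t; rewrite /A/= in_itv/= => tA; exact: gap_kernel_integral_le.
Qed.
End TonelliSwap.

(** * Sharp bound for Zolotarev ratios *)

Section ZolotarevBound.
Context {R : realType}.
Local Open Scope classical_set_scope.
Local Notation mu := (@lebesgue_measure R).

Lemma ellipticKE (m : R) (F am : R -> R) : 0 <= m -> m < 1 ->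
  is_amplitude m F am -> ellipticK (Num.sqrt m) = F (pi / 2).
Proof.
move=> m0 m1 Fam; have E := ellipticK_integral m0 m1 Fam.
rewrite /ellipticK /Rintegral sqr_sqrtr//.
by rewrite -[RHS]/(fine (F (pi / 2))%:E) -E.
Qed.

Lemma legendre_integral (m : R) : 0 <= m -> m < 1 ->
  (\int[mu]_(y in `]0%R, 1%R[) (legendre m y)%:E = (ellipticK (Num.sqrt m))%:E)%E.
Proof.
move=> m0 m1; have [F [am Fam]] := amplitude_exists m0 m1.
by rewrite (ellipticKE m0 m1 Fam); exact: (ellipticK_integral m0 m1 Fam).
Qed.

Lemma ellipticK_gt0 (l : R) : 0 <= l -> l < 1 -> 0 < ellipticK l.
Proof.
move=> l0 l1; have m1 : l ^+ 2 < 1 by rewrite expr_lt1.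
have [F [am Fam]] := amplitude_exists (sqr_ge0 l) m1.
have := ellipticKE (sqr_ge0 l) m1 Fam; rewrite sqrtr_sqr ger0_norm// => ->.
exact: (half_period_gt0 (sqr_ge0 l) m1 Fam).
Qed.

Section Modulus.
Context (m : R) (m0 : 0 < m) (m1 : m < 1).
Context (F am : R -> R) (Fam : is_amplitude m F am).
Let m0' : 0 <= m. Proof. exact: ltW. Qed.
Let V := F (pi / 2).
Let K := ellipticK (Num.sqrt (1 - m)).
Let d := dn m am.
Let V0 : 0 < V. Proof. exact: (half_period_gt0 m0' m1 Fam). Qed.
Let d_gt0 v : 0 < d v. Proof. exact: (dn_gt0 m0' m1 am v). Qed.
Let d_le1 v : d v <= 1. Proof. exact: (dn_le1 m0' am v). Qed.
Let d_decr (x y : R) : 0 <= x -> x < y -> y <= V -> d y < d x.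
Proof. exact: (dn_decreasing m0' m1 Fam m0). Qed.
Let d_even v : d (- v) = d v. Proof. exact: (dn_even Fam). Qed.
Let d_period v : d (v + 2 * V) = d v. Proof. exact: (dn_period Fam). Qed.
Let d_mul (u w : R) : (1 - d (u + w)) / (1 + d (u + w)) *
  ((1 - d (u - w)) / (1 + d (u - w))) = ((d u - d w) / (d u + d w)) ^+ 2.
Proof. exact: (dnratio_mul m0' m1 Fam). Qed.

(** A bound for arbitrarily fine Riemann sums bounds the integral, which is at
    least [pi K] by Tonelli. Here [K] belongs to the complementary modulus, as
    [m] is the parameter of [dn]. *)
Lemma legendre_mean_le (C : R) :
  (forall N : nat, exists2 M : nat, (N <= M)%N &
     V / M%:R * \sum_(i < M) - ln (dnratio m am (i.+1%:R * V / M%:R)) <= C) ->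
  pi * K <= C.
Proof.
move=> hC; have h1 := loggap_integral_bound m0 m1 Fam hC.
have h2 := loggap_integral_ge m0 m1; rewrite -lee_fin.
apply: le_trans h1; apply: le_trans h2.
have m10 : 0 <= 1 - m by rewrite subr_ge0 ltW.
have m11 : 1 - m < 1 by rewrite ltrBlDr ltrDl.
under eq_integral do rewrite EFinM.
rewrite ge0_integralZl_EFin.
- by rewrite legendre_integral// EFinM.
- exact: measurable_itv.
- by move=> y _; rewrite lee_fin legendre_ge0.
- by apply: measurable_fun_oo => y yB; exact: (continuous_legendre m10 m11 yB).
- exact: pi_ge0.
Qed.

(** The iterated doubling gives [2^N log (s/2) <= log P], where [P] is the product
    bounding the ratio for [M = 2^N k]. After division by [M] the right-hand side
    is a Riemann sum, which is at most the mean in the limit, while the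
    left-hand side does not depend on [N]. *)
Lemma zolo_ratio_bound (k : nat) (v : R) : (0 < k)%N ->
  zolo_ratio d V k v <= 2 * expR (- (k%:R * (pi * K / V))).
Proof.
move=> k0; set s := zolo_ratio d V k v.
have s0 : 0 <= s by exact: zolo_ratio_ge0.
move: s0; rewrite le_eqVlt => /predU1P[<-|s0]; first by rewrite mulr_ge0// expR_ge0.
have kR : 0 < k%:R :> R by rewrite ltr0n.
have s2 : 0 < s / 2 by rewrite divr_gt0.
have : pi * K <= V / k%:R * - ln (s / 2).
  apply: legendre_mean_le => N; exists (2 ^ N * k)%N.
    by rewrite (leq_trans (ltnW (ltn_expl N (ltnSn 1))))// leq_pmulr.
  have := zolo_ratio_iter V0 d_even d_period d_gt0 d_le1 d_decr d_mul v N k0.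
  rewrite -/s; set M := (2 ^ N * k)%N.
  have M0 : (0 < M)%N by rewrite muln_gt0 expn_gt0.
  have MR : 0 < M%:R :> R by rewrite ltr0n.
  pose ph (i : 'I_M) := dnratio m am (i.+1%:R * V / M%:R).
  have ph0 i : 0 < ph i.
    have i0 : 0 < i.+1%:R * V / M%:R by rewrite divr_gt0// mulr_gt0.
    have iV : i.+1%:R * V / M%:R <= V.
      by rewrite ler_pdivrMr// mulrC ler_pM2l// ler_nat.
    have h := d_decr (lexx 0) i0 iV; have h2 := d_gt0 (i.+1%:R * V / M%:R).
    have d0 : d 0 = 1 by exact: (dn0 Fam).
    by rewrite d0 in h; rewrite /ph divr_gt0 ?subr_gt0 ?addr_gt0.
  have -> : \prod_(i < M) ((1 - d (i.+1%:R * V / M%:R)) / (1 + d (i.+1%:R * V / M%:R)))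
     = \prod_(i < M) ph i by [].
  have -> : \sum_(i < M) - ln (dnratio m am (i.+1%:R * V / M%:R)) =
            - ln (\prod_(i < M) ph i).
    rewrite sumrN; congr (- _).
    have lnprod n (u : 'I_n -> R) : (forall i, 0 < u i) ->
        \sum_(i < n) ln (u i) = ln (\prod_(i < n) u i).
      elim: n u => [|n IH] u u0; first by rewrite !big_ord0 ln1.
      rewrite !big_ord_recr/= IH// lnM// posrE ?prodr_gt0//.
    exact: lnprod.
  have P0 : 0 < \prod_(i < M) ph i by exact: prodr_gt0.
  move: (\prod_(i < M) ph i) P0 => P P0 hP.
  have hl : (2 ^ N)%:R * ln (s / 2) <= ln P.
    rewrite mulrC mulr_natr -lnXn// ler_ln ?posrE ?exprn_gt0//.
    by rewrite (le_trans hP)// ler_pdivrMr// ler_peMr ?ler1n// ltW.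
  have -> : V / k%:R * - ln (s / 2) = V / M%:R * - ((2 ^ N)%:R * ln (s / 2)).
    rewrite /M natrM; field; rewrite ?gt_eqF// ltr0n expn_gt0//.
  by rewrite ler_pM2l ?divr_gt0// lerN2.
move=> h; rewrite mulrC -ler_pdivrMr// -ler_ln ?posrE ?expR_gt0// expRK.
rewrite lerNr mulrA ler_pdivrMr//.
have := ler_wpM2l (ltW kR) h.
by rewrite (_ : k%:R * (V / k%:R * _) = - ln (s / 2) * V)//; field; rewrite gt_eqF.
Qed.


Lemma zolotarev_nodes_of_modulus (k : nat) : (0 < k)%N ->
  exists xs : seq R, [/\ size xs = k, all (fun x => 0 < x) xs &
   forall t, Num.sqrt (1 - m) <= t <= 1 -> \prod_(x <- xs) `|t - x| <=
     2 * expR (- (k%:R * (pi * K / V))) * \prod_(x <- xs) (t + x)].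
Proof.
move=> k0; exists [seq zolo_node d V k i | i <- iota 0 k]; split.
- by rewrite size_map size_iota.
- by apply/allP => x /mapP [l _ ->]; exact: d_gt0.
move=> t /(dn_surjective m0' m1 Fam)[v _ <-].
have xsE (g : R -> R) : \prod_(x <- [seq zolo_node d V k i | i <- iota 0 k]) g x =
    \prod_(i < k) g (zolo_node d V k i).
  by rewrite big_map -(big_mkord xpredT (fun i => g (zolo_node d V k i))) /index_iota subn0.
rewrite !xsE -/d -/V.
have D0 : 0 < \prod_(i < k) (d v + zolo_node d V k i).
  by apply: prodr_gt0 => i _; rewrite addr_gt0//; exact: d_gt0.
by rewrite -ler_pdivrMr// -prodf_div; exact: zolo_ratio_bound.
Qed.

(** The single node is [a = dn (V/2)], whose square is [dn V]. The claim reads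
    [(1 - a^2)/(1 + a^2) <= 2 (1 - a)/(1 + a)], that is
    [(1 + a)^2 <= 2 (1 + a^2)]. *)
Lemma zolo_ratio1_ge : (1 - d V) / (1 + d V) <= 2 * zolo_ratio d V 1 0.
Proof.
have dV0 := d_gt0 V; pose a := d (V / 2); have a0 : 0 < a := d_gt0 _.
have d0 : d 0 = 1 by exact: (dn0 Fam).
have v20 : 0 < V / 2 by rewrite divr_gt0.
have v2V : V / 2 < V by rewrite ltr_pdivrMr// ltr_pMr// ltr1n.
have lt1 : a < 1.
  by rewrite -d0; apply: d_decr; [exact: lexx|exact: v20|exact: ltW].
have lt2 : d V < a by apply: d_decr; [exact: ltW|exact: v2V|exact: lexx].
have -> : zolo_ratio d V 1 0 = (1 - a) / (1 + a).
  rewrite /zolo_ratio big_ord1 d0 /zolo_node muln0 add0n !mul1r mulr1 -/a gtr0_norm//.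
  by rewrite subr_gt0.
have := d_mul V (V / 2); rewrite -/a.
have -> : d (V + V / 2) = a.
  by rewrite -d_even -d_period /a; congr d; field.
have -> : d (V - V / 2) = a by rewrite /a; congr d; field.
have q0 : 0 < (1 - a) / (1 + a) by rewrite divr_gt0 ?subr_gt0 ?addr_gt0.
have q1 : 0 < (a - d V) / (a + d V) by rewrite divr_gt0 ?subr_gt0 ?addr_gt0.
rewrite -expr2 -[d V - a]opprB mulNr sqrrN [d V + a]addrC => /eqP.
rewrite (eqrXn2 (ltn0Sn 1) (ltW q0) (ltW q1)) => /eqP E.
have aE : d V = a ^+ 2.
  have n1 : 1 + a != 0 by rewrite gt_eqF// addr_gt0.
  have n2 : a + d V != 0 by rewrite gt_eqF// addr_gt0.
  have : (1 - a) * (a + d V) = (a - d V) * (1 + a).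
    by apply/eqP; rewrite -eqr_div// E.
  by lra.
rewrite aE ler_pdivrMr; last by rewrite addr_gt0 ?exprn_gt0.
rewrite mulrA mulrAC ler_pdivlMr ?addr_gt0//.
have : 0 <= (1 - a) * (1 - a) ^+ 2 by rewrite mulr_ge0 ?sqr_ge0// subr_ge0 ltW.
lra.
Qed.

End Modulus.

(** Nodes for the interval [[l, 1]]: here [dn] has the parameter [1 - l^2], so
    its half period is [K(sqrt(1 - l^2))] and
    [pi K(l)/K(sqrt(1 - l^2)) = pi^2/(2 mu(l))]. *)
Theorem zolotarev_nodes (l : R) (k : nat) : 0 < l -> l < 1 -> (0 < k)%N ->
  exists xs : seq R, [/\ size xs = k, all (fun x => 0 < x) xs &
   forall t, l <= t <= 1 -> \prod_(x <- xs) `|t - x| <=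
     2 * expR (- (k%:R * (pi ^+ 2 / (2 * grotzsch_mu l)))) * \prod_(x <- xs) (t + x)].
Proof.
move=> l0 l1 k0; have l2 : l ^+ 2 < 1 by rewrite expr_lt1// ltW.
have l20 : 0 < l ^+ 2 by rewrite exprn_gt0.
pose m := 1 - l ^+ 2.
have m0 : 0 < m by rewrite subr_gt0.
have m1 : m < 1 by rewrite ltrBlDr ltrDl.
have [F [am Fam]] := amplitude_exists (ltW m0) m1.
have lE : Num.sqrt (1 - m) = l by rewrite /m subKr sqrtr_sqr ger0_norm// ltW.
have := zolotarev_nodes_of_modulus m0 m1 Fam k0.
rewrite lE -(ellipticKE (ltW m0) m1 Fam) -/m.
suff -> : pi ^+ 2 / (2 * grotzsch_mu l) = pi * ellipticK l / ellipticK (Num.sqrt m) by [].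
have K0 := ellipticK_gt0 (ltW l0) l1.
have K1 : 0 < ellipticK (Num.sqrt m).
  by apply: ellipticK_gt0; rewrite ?sqrtr_ge0// -sqrtr1 ltr_sqrt.
have p0 := @pi_gt0 R; rewrite /grotzsch_mu -/m.
by move: pi p0 => P P0; field; rewrite !gt_eqF.
Qed.

Lemma grotzsch_mu_gt0 (l : R) : 0 < l -> l < 1 -> 0 < grotzsch_mu l.
Proof.
move=> l0 l1; have l20 : 0 < l ^+ 2 by rewrite exprn_gt0.
rewrite /grotzsch_mu mulr_gt0 ?divr_gt0 ?pi_gt0 ?ellipticK_gt0 ?sqrtr_ge0 ?(ltW l0)//.
by rewrite -[ltRHS]sqrtr1 ltr_sqrt// ltrBlDr ltrDl.
Qed.

(** Take the one-node bound with the modulus [l] in the role of the parameter's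
    root: with [c = sqrt (1 - l^2)] it reads
    [(1 - c)/(1 + c) <= 4 exp (- 2 mu(l))], and the left-hand side is
    [l^2/(1 + c)^2 >= l^2/4]. *)
Lemma grotzsch_mu_le (l : R) : 0 < l -> l < 1 -> grotzsch_mu l <= ln (4 / l).
Proof.
move=> l0 l1; have m1 : l ^+ 2 < 1 by rewrite expr_lt1// ltW.
have m0 : 0 < l ^+ 2 by rewrite exprn_gt0.
have [F [am Fam]] := amplitude_exists (ltW m0) m1.
have h1 := zolo_ratio1_ge m0 m1 Fam; have h2 := zolo_ratio_bound m0 m1 Fam 0 (ltn0Sn 0).
have := le_trans h1 (ler_wpM2l (ler0n _ 2) h2).
have -> : dn (l ^+ 2) am (F (pi / 2)) = Num.sqrt (1 - l ^+ 2) by exact: (dnV Fam).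
rewrite -(ellipticKE (ltW m0) m1 Fam) mul1r sqrtr_sqr (ger0_norm (ltW l0)).
set c := Num.sqrt _; set q := pi * _ / _ => h.
have c2 : c ^+ 2 = 1 - l ^+ 2 by rewrite sqr_sqrtr// subr_ge0 ltW.
have c0 : 0 <= c by exact: sqrtr_ge0.
have c1 : c <= 1 by rewrite /c -[leRHS]sqrtr1 ler_wsqrtr// lerBlDr lerDl ltW.
have : (l / 4) ^+ 2 <= expR (- q).
  have : l ^+ 2 / 4 <= (1 - c) / (1 + c).
    rewrite ler_pdivlMr ?ltr_wpDr// mulrAC ler_pdivrMr//.
    have := mulr_ge0 c0 c0; nra.
  by lra.
have l4 : 0 < l / 4 by rewrite divr_gt0.
rewrite -ler_ln ?posrE ?exprn_gt0 ?expR_gt0// expRK lnXn// => hq.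
have -> : grotzsch_mu l = q / 2.
  by rewrite /grotzsch_mu -/c /q; ring.
have -> : ln (4 / l) = - ln (l / 4) by rewrite -lnV ?posrE// invf_div.
by lra.
Qed.
End ZolotarevBound.

(** * The decay bound *)

Section KrylovDecay.
Context {R : realType}.
Local Notation C := R[i].
Local Open Scope classical_set_scope.

Lemma sigma_nonincreasing m n (X : 'M[C]_(m, n)) (i j : nat) :
  (1 <= j)%N -> (j <= i)%N -> (i <= n)%N -> sigma i X <= sigma j X.
Proof.
move=> j1 ji iN; rewrite -[leRHS]mul1r.
apply: (@sigma_compare _ _ _ n X 1%:M 1%:M) => //.
- by rewrite iN (leq_trans j1).
- by rewrite leq_add2l.
- exact: leq_trans iN.
- by move=> f; rewrite mul1mx.
- by move=> f; rewrite expr1n mul1r.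
Qed.

Lemma le_tan (x : R) : 0 <= x -> x < pi / 2 -> x <= tan x.
Proof.
move=> x0 xp; have p0 := @pi_gt0 R.
have c0 (z : R) : 0 <= z -> z <= x -> 0 < cos z.
  by move=> z0 zx; apply: cos_gt0_pihalf; apply/andP; split; lra.
have dT (z : R) : z \in `]0, x[%R -> is_derive z 1 (@tan R) ((cos z) ^- 2).
  rewrite in_itv/= => /andP[z0 zx]; apply: is_derive_tan.
  by rewrite gt_eqF// c0// ltW.
have cT : {within `[0, x], continuous (@tan R)}.
  apply: continuous_in_subspaceT => z; rewrite inE/= in_itv/= => /andP[z0 zx].
  by apply: continuous_tan; rewrite gt_eqF// c0.
have [z] := @MVT_segment R (@tan R) (fun z => (cos z) ^- 2) 0 x x0 dT cT.
rewrite in_itv/= => /andP[z0 zx]; rewrite tan0 !subr0 => ->.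
rewrite ler_peMl// invf_ge1 ?exprn_gt0 ?c0// expr_le1 ?cos_le1// ltW// c0.
Qed.

Section Modulus.
Context (p : nat) (p1 : (2 <= p)%N).
Let e : R := pi / (4 * p%:R).
Let l : R := tan e ^+ 2.

Let pR : 2 <= p%:R :> R. Proof. by rewrite ler_nat. Qed.
Let e_gt0 : 0 < e.
Proof. by rewrite divr_gt0 ?pi_gt0// mulr_gt0//; have := pR; lra. Qed.
Let e_lt : e < pi / 4.
Proof.
have p2 := pR; have p40 : 0 < 4 * p%:R :> R by lra.
by rewrite /e ltr_pM2l ?pi_gt0// ltf_pV2 ?posrE//; lra.
Qed.

Lemma tan_modulus : e ^+ 2 <= l /\ l < 1.
Proof.
have e0 := e_gt0; have e1 := e_lt; have p0 := @pi_gt0 R.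
have et : e <= tan e by apply: le_tan; lra.
have t1 : tan e < 1.
  by rewrite -tan_piquarter ltr_tan// in_itv/=; apply/andP; split; lra.
split; first by apply: lerXn2r; rewrite ?nnegrE; lra.
by rewrite expr_lt1//; lra.
Qed.

Lemma modulus_gt0 : 0 < l.
Proof. by have [h _] := tan_modulus; apply: lt_le_trans h; rewrite exprn_gt0. Qed.

Lemma ln_modulus_gt0 : 0 < ln (8 * p%:R / pi : R).
Proof.
have p0 := @pi_gt0 R; have p4 := @pihalf_lt2 R; have p2 := pR.
rewrite ln_gt0// ltr_pdivlMr//; lra.
Qed.

Lemma grotzsch_mu_modulus : 2 * grotzsch_mu l <= 4 * ln (8 * p%:R / pi).
Proof.
have [le l1] := tan_modulus; have l0 := modulus_gt0.
have p0 := @pi_gt0 R; have p2 := pR; have e0 := e_gt0.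
have h := grotzsch_mu_le l0 l1.
have h2 : ln (4 / l) <= 2 * ln (8 * p%:R / pi).
  have q0 : 0 < 8 * p%:R / pi :> R by rewrite divr_gt0//; lra.
  have q1 : 0 < 4 / l by rewrite divr_gt0.
  rewrite [leRHS]mulr_natl -lnXn// ler_ln ?posrE ?exprn_gt0//.
  have -> : (8 * p%:R / pi) ^+ 2 = 4 / e ^+ 2 :> R.
    have pn : p%:R != 0 :> R by rewrite gt_eqF//; lra.
    rewrite /e; move: (pi : R) p0 => P P0; field.
    by rewrite pn gt_eqF.
  by rewrite ler_pM2l// lef_pV2// posrE exprn_gt0.
lra.
Qed.
End Modulus.

(** For odd [n] Parseval is used with [n - 1] points, which costs one unit of
    [k]. *)
Lemma krylov_decay m n (A : 'M[C]_m) (w : 'cV[C]_m) (j k p : nat) :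
  A \is hermsymmx -> (2 <= p)%N -> n = (odd n + 2 * p)%N -> (1 <= j)%N ->
  (j + 2 * k <= n)%N -> (odd n < k)%N ->
  sigma (j + 2 * k) (krylov n A w) <=
  4 * expR (- ((k - odd n)%:R *
    (pi ^+ 2 / (2 * grotzsch_mu (tan (pi / (4 * p%:R)) ^+ 2))))) *
  sigma j (krylov n A w).
Proof.
move=> hA p2 nE j1 jk ok.
have [_ l1] := tan_modulus p2; have l0 := modulus_gt0 p2.
have kk0 : (0 < k - odd n)%N by rewrite subn_gt0.
have [xs [sxs xs0 hxs]] := zolotarev_nodes l0 l1 kk0.
rewrite (_ : 4 * expR _ = 2 * (2 * expR (- ((k - odd n)%:R *
    (pi ^+ 2 / (2 * grotzsch_mu (tan (pi / (4 * p%:R)) ^+ 2))))))); last by ring.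
apply: (@sigma_krylov _ _ _ _ _ p _ _ (tan (pi / (4 * p%:R))) _ xs hA);
  [lia|lia|by []|by rewrite mulr_ge0// expR_ge0|exact: xs0|exact: hxs|lia|lia| |];
  rewrite sxs; lia.
Qed.

End KrylovDecay.
Unset Implicit Arguments.

Theorem corollary5p2 (R : realType) (m n : nat) (hn : (2 <= n)%N)
    (hmn : (n <= m)%N) (A : 'M[R[i]]_m) (hA : A \is hermsymmx)
    (w : 'cV[R[i]]_m) :
  ((4 <= n)%N ->
     forall j k : nat, (1 <= j)%N -> (1 <= j + 2 * k <= n)%N ->
       sigma (j + 2 * k) (krylov n A w) <=
         4 * expR (pi ^+ 2 /
                     (2 * grotzsch_mu (tan (pi / (4 * n./2%:R)) ^+ 2)))
               ^ (- k%:Z + (odd n)%:Z)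
         * sigma j (krylov n A w)) /\
  (forall j k : nat, (1 <= j)%N -> (1 <= j + 2 * k <= n)%N ->
     sigma (j + 2 * k) (krylov n A w) <=
       4 * expR (pi ^+ 2 / (4 * ln (8 * n./2%:R / pi)))
             ^ (- k%:Z + (odd n)%:Z)
       * sigma j (krylov n A w)).
Proof.
(* When [k <= odd n] the exponent is nonnegative, the factor is at least [4], and
   monotonicity of [sigma] suffices; this covers [n = 2] and [n = 3]. *)
have trivial (j k : nat) (x : R) : (1 <= j)%N -> (1 <= j + 2 * k <= n)%N ->
    (k <= odd n)%N -> 0 <= x ->
    sigma (j + 2 * k) (krylov n A w) <=
    4 * expR x ^ (- k%:Z + (odd n)%:Z) * sigma j (krylov n A w).
  move=> j1 /andP[_ jk] ko x0; have s0 := sigma_ge0 (krylov n A w) j.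
  apply: (@le_trans _ _ (sigma j (krylov n A w))).
    by apply: sigma_nonincreasing => //; lia.
  have -> : - k%:Z + (odd n)%:Z = (odd n - k)%N%:Z by lia.
  rewrite -exprnP ler_peMl//.
  have : 1 <= expR x ^+ (odd n - k) by rewrite exprn_ege1// -expR0 ler_expR.
  lra.
have power (k : nat) (x : R) : (odd n < k)%N ->
    exprz (expR x) (- k%:Z + (odd n)%:Z) = expR (- ((k - odd n)%:R * x)).
  move=> ok; have -> : - k%:Z + (odd n)%:Z = - (k - odd n)%N%:Z by lia.
  by rewrite -exprz_inv -exprnP -expRN -expRM_natl mulrN.
have nE : n = (odd n + 2 * n./2)%N by rewrite mul2n odd_double_half.
split=> [n4 j k j1 jk|j k j1 jk].
  have p2 : (2 <= n./2)%N by lia.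
  have [_ l1] := @tan_modulus R _ p2; have l0 := @modulus_gt0 R _ p2.
  have [ko|ok] := leqP k (odd n).
    apply: trivial => //; rewrite divr_ge0 ?sqr_ge0// mulr_ge0// ltW//.
    exact: grotzsch_mu_gt0.
  rewrite power//; apply: (krylov_decay w hA p2 nE j1 _ ok).
  by case/andP: jk.
have [ko|ok] := leqP k (odd n).
  apply: trivial => //; rewrite divr_ge0 ?sqr_ge0// mulr_ge0// ln_ge0//.
  have p0 := @pi_gt0 R; have p4 := @pihalf_lt2 R.
  have h1 : 1 <= n./2%:R :> R by rewrite ler1n; lia.
  by rewrite ler_pdivlMr//; lra.
have p2 : (2 <= n./2)%N by lia.
have [_ l1] := @tan_modulus R _ p2; have l0 := @modulus_gt0 R _ p2.
apply: (le_trans (krylov_decay w hA p2 nE j1 _ ok)); first by case/andP: jk.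
rewrite power//; apply: ler_wpM2r; first exact: sigma_ge0.
rewrite ler_pM2l// ler_expR lerN2 ler_pM2l; last by rewrite ltr0n subn_gt0.
rewrite ler_pM2l ?exprn_gt0 ?pi_gt0//.
have mu0 : 0 < 2 * grotzsch_mu (tan (pi / (4 * n./2%:R)) ^+ 2) :> R.
  by rewrite mulr_gt0// grotzsch_mu_gt0.
have ln0 : 0 < 4 * ln (8 * n./2%:R / pi) :> R by rewrite mulr_gt0// ln_modulus_gt0.
by rewrite lef_pV2 ?posrE//; exact: grotzsch_mu_modulus.
Qed.
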